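(* Let $k\ge0$ be an integer and let $\theta_1,\dots,\theta_k\in\Omega^1(G)$ be linearly independent with $\operatorname{im} d\cap\mathrm{Vect}(\theta_1,\dots,\theta_k)=\{0\}$; set $\vartheta=\theta_1\wedge\dots\wedge\theta_k$. Let $\omega_\vartheta:\mathbb K^k\to\Omega^1(G)$, $(t_1,\dots,t_k)\mapsto t_1\theta_1+\dots+t_k\theta_k$, let $d\oplus\omega_\vartheta:(\ker d)^\perp\oplus\mathbb K^k\to\Omega^1(G)$ be the map $(f,t)\mapsto df+\omega_\vartheta(t)$, where the direct sum is orthogonal and $\mathbb K^k$ has its usual inner product, and let $\Delta_\vartheta=(d\oplus\omega_\vartheta)^*(d\oplus\omega_\vartheta)$. Then $$C_k(\vartheta,\underline x)=T(\underline x)\,\big\|(\Pi^{\ker d^*})^{\wedge k}(\vartheta)\big\|^2=|V|^{-1}\det\Delta_\vartheta,$$ where $C_k(\vartheta,\underline x)=\sum_{K\in\mathcal C_k(G)}|(\vartheta,\det\mathscr Z^K)|^2\,\underline x^K$ and $T(\underline x)=\sum_{T\in\mathcal T(G)}\underline x^T$.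
   Context: Let $\mathbb K=\mathbb R$ or $\mathbb C$. $G=(V,E)$ is a finite connected graph: $V$ is a finite set of vertices and $E$ a finite set of oriented edges, with source and target maps $s,t:E\to V$ and a fixed-point-free involution $e\mapsto e^{-1}$ of $E$ exchanging source and target. $E^+\subset E$ is a fixed subset containing exactly one element of each pair $\{e,e^{-1}\}$. Positive weights $\underline x=(x_e)_{e\in E}$ with $x_{e^{-1}}=x_e$ are given, and $\underline x^A=\prod_{e\in (A\cup A^{-1})\cap E^+}x_e$ for $A\subseteq E$. A subgraph of $G$ is a subset $S\subseteq E$ stable under $e\mapsto e^{-1}$, seen as the graph $(V,S)$. $\mathcal T(G)$ is the set of spanning trees of $G$; $\mathcal C_k(G)$ is the set of connected (spanning) subgraphs with first Betti number $k$. $C_1(G)$ is the free abelian group on $E$ modulo $e+e^{-1}=0$; $\partial e=t(e)-s(e)$ in the free abelian group on $V$; for a subgraph $K$, $Z_1(K)$ is the kernel of $\partial$ on the subgroup of $C_1(G)$ generated by the edges of $K$. $\Omega^0(G)$ is the space of functions $V\to\mathbb K$ with inner product $\langle f,g\rangle=\sum_{v}\overline{f(v)}g(v)$; $\Omega^1(G)=\mathrm{Hom}(C_1(G),\mathbb K)$ has inner product $\langle\alpha,\beta\rangle=\sum_{e\in E^+}x_e\overline{\alpha(e)}\beta(e)$. $d:\Omega^0(G)\to\Omega^1(G)$, $df(e)=f(t(e))-f(s(e))$, and $d^*$ is its adjoint. $\Pi^{L}$ denotes the orthogonal projection on a subspace $L$, and $a^{\wedge k}$ the map induced by $a$ on $k$-th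 exterior powers. Exterior powers carry the inner product $\langle u_1\wedge\dots\wedge u_k,v_1\wedge\dots\wedge v_k\rangle=\det(\langle u_i,v_j\rangle)$. For $K\in\mathcal C_k(G)$, $\mathscr Z^K=(z_1,\dots,z_k)$ is any $\mathbb Z$-basis of $Z_1(K)$, and $|(\vartheta,\det\mathscr Z^K)|^2=|\det(\theta_i(z_j))_{1\le i,j\le k}|^2$. *)

(* Defs.v *)
From HB Require Import structures.
From mathcomp Require Import fingroup perm.
From mathcomp Require Import all_boot all_order all_algebra ring_quotient.
From mathcomp Require Import complex.
From mathcomp Require Import boolp classical_sets reals.

Set Implicit Arguments.
Unset Strict Implicit.
Unset Printing Implicit Defensive.

Import Order.TTheory GRing.Theory Num.Theory.
Local Open Scope ring_scope.
Local Open Scope quotient_scope.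

Variant field_kind := RealScalars | ComplexScalars.

Definition scalars (R : realType) (F : field_kind) : numFieldType :=
  match F with
  | RealScalars => R : numFieldType
  | ComplexScalars => R[i] : numFieldType
  end.

Definition sconj (R : realType) (F : field_kind) : scalars R F -> scalars R F :=
  match F return scalars R F -> scalars R F with
  | RealScalars => fun z => z
  | ComplexScalars => @conjc R
  end.
Arguments sconj {R F}.

Section Scalars.
Variables (R : realType) (F : field_kind).
Local Notation K := (scalars R F).

Fact sconj_is_additive : zmod_morphism (@sconj R F).
Proof. by case: F => x y; [|exact: (rmorphB (@conjc R))]. Qed.

Fact sconj_is_multiplicative : monoid_morphism (@sconj R F).
Proof.
case: F; split => // [|x y]; first exact: (rmorph1 (@conjc R)).
exact: (rmorphM (@conjc R)).
Qed.

HB.instance Definition _ :=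
  GRing.isZmodMorphism.Build K K (@sconj R F) sconj_is_additive.
HB.instance Definition _ :=
  GRing.isMonoidMorphism.Build K K (@sconj R F) sconj_is_multiplicative.

Lemma sconjK : involutive (@sconj R F).
Proof. by case: F => //= z; rewrite conjcK. Qed.

Lemma mul_sconj (z : K) : z * sconj z = `|z| ^+ 2.
Proof.
case: F z => /= z; first by rewrite real_normK ?num_real// expr2.
by rewrite sqr_normc.
Qed.

Lemma sconj_pos (z : K) : 0 < z -> sconj z = z.
Proof.
move=> z0; apply: (mulfI (lt0r_neq0 z0)).
by rewrite mul_sconj gtr0_norm// expr2.
Qed.

End Scalars.

(* Library forms are linear in the first variable and conjugate-linear in the
   second one: '[u, v] is the number written <v, u> when inner products are
   conjugate-linear in the first variable. *)
Notation inner R F V := {dot V for @sconj R F}.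

Section InnerProducts.
Variables (R : realType) (F : field_kind).
Local Notation K := (scalars R F).

Section Constructor.
Variables (V : lmodType K) (f : V -> V -> K).
Hypothesis f_lin : forall w a u v, f (a *: u + v) w = a * f u w + f v w.
Hypothesis f_conj : forall u v, f u v = sconj (f v u).
Hypothesis f_pos : forall u, u != 0 -> 0 < f u u.

Fact mk_inner_bilinear :
  bilinear_for (GRing.Scale.Law.clone _ _ *%R _)
               (GRing.Scale.Law.clone _ _ (@sconj R F \; *%R) _) f.
Proof.
split=> w a u v /=; first exact: f_lin.
by rewrite f_conj f_lin rmorphD rmorphM /= -!f_conj.
Qed.

Fact mk_inner_conj u v : f u v = (-1) ^+ false * sconj (f v u).
Proof. by rewrite expr0 mul1r. Qed.

Definition mk_inner : inner R F V :=
  HB.pack_for (inner R F V) f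
    (bilinear_isBilinear.Build K V V K _ _ f mk_inner_bilinear)
    (isHermitianSesquilinear.Build K V false (@sconj R F) f mk_inner_conj)
    (isDotProduct.Build K V f f_pos).

End Constructor.

Lemma innerC (V : lmodType K) (f : inner R F V) u v : f u v = sconj (f v u).
Proof. by rewrite (hermC f) expr0 mul1r. Qed.

Lemma inner_eq0 (V : lmodType K) (f : inner R F V) v : f v v = 0 -> v = 0.
Proof.
move=> fv0; apply/eqP; apply: contraT => v0.
by have := @neq0_dnorm_gt0 _ _ _ f v v0; rewrite fv0 ltxx.
Qed.

Section Standard.
Variable I : finType.
Implicit Types u v w : {ffun I -> K^o}.

Definition std_form u v : K := \sum_i u i * sconj (v i).

Fact std_form_lin w a u v :
  std_form (a *: u + v) w = a * std_form u w + std_form v w.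
Proof.
rewrite /std_form mulr_sumr -big_split; apply: eq_bigr => i _ /=.
by rewrite !ffunE mulrDl mulrA.
Qed.

Fact std_form_conj u v : std_form u v = sconj (std_form v u).
Proof.
rewrite /std_form rmorph_sum; apply: eq_bigr => i _ /=.
by rewrite rmorphM /= sconjK mulrC.
Qed.

Fact std_form_pos u : u != 0 -> 0 < std_form u u.
Proof.
move=> u0; rewrite lt_def sumr_ge0 => [|i _]; last by rewrite mul_sconj exprn_ge0.
rewrite andbT; apply: contraNneq u0 => /eqP.
rewrite psumr_eq0 => [/allP ui0|i _]; last by rewrite mul_sconj exprn_ge0.
apply/eqP/ffunP => i; rewrite ffunE; apply/eqP.
by have := ui0 i (mem_index_enum _); rewrite /= mul_sconj sqrf_eq0 normr_eq0.
Qed.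

Definition inner_std : inner R F {ffun I -> K^o} :=
  mk_inner std_form_lin std_form_conj std_form_pos.

End Standard.

Section Subspace.
Variables (V : vectType K) (f : inner R F V) (U : {vspace V}).
Implicit Types u v w : subvs_of U.

Definition sub_form u v : K := f (vsval u) (vsval v).

Fact sub_form_lin w a u v :
  sub_form (a *: u + v) w = a * sub_form u w + sub_form v w.
Proof. by rewrite /sub_form linearP linearPl. Qed.

Fact sub_form_conj u v : sub_form u v = sconj (sub_form v u).
Proof. exact: innerC. Qed.

Fact sub_form_pos u : u != 0 -> 0 < sub_form u u.
Proof. by move=> u0; apply: neq0_dnorm_gt0. Qed.

Definition inner_sub : inner R F (subvs_of U) :=
  mk_inner sub_form_lin sub_form_conj sub_form_pos.

End Subspace.

Section DirectSum.
Variables (V W : vectType K) (f : inner R F V) (g : inner R F W).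
Implicit Types u v w : (V * W)%type.

Definition sum_form u v : K := f u.1 v.1 + g u.2 v.2.

Fact sum_form_lin w a u v :
  sum_form (a *: u + v) w = a * sum_form u w + sum_form v w.
Proof. by rewrite /sum_form /= !linearPl /= mulrDr addrACA. Qed.

Fact sum_form_conj u v : sum_form u v = sconj (sum_form v u).
Proof. by rewrite /sum_form rmorphD /= -!innerC. Qed.

Fact sum_form_pos u : u != 0 -> 0 < sum_form u u.
Proof.
have ge0 (U : vectType K) (h : inner R F U) z : 0 <= h z z.
  by have [->|/neq0_dnorm_gt0/ltW//] := eqVneq z 0; rewrite linear0r.
case: u => x y; rewrite /sum_form xpair_eqE negb_and => /orP[x0|y0] /=.
  by rewrite ltr_wpDr ?ge0 ?neq0_dnorm_gt0.
by rewrite ltr_wpDl ?ge0 ?neq0_dnorm_gt0.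
Qed.

Definition inner_sum : inner R F (V * W)%type :=
  mk_inner sum_form_lin sum_form_conj sum_form_pos.

End DirectSum.

Section Adjoint.
Variables (V W : vectType K) (f : inner R F V) (g : inner R F W).
Implicit Type a : 'Hom(V, W).

Definition adjoint a : 'Hom(W, V) :=
  xget 0 [set b : 'Hom(W, V) | forall v w, g (a v) w = f v (b w)].

Lemma adjoint_ex a : exists b : 'Hom(W, V), forall v w, g (a v) w = f v (b w).
Proof.
pose e := vbasis {:V}.
pose G : 'M[K]_(\dim {:V}) := \matrix_(i, j) f e`_i e`_j.
have eP v : v = \sum_i coord e i v *: e`_i by apply: coord_vbasis; apply: memvf.
have G_unit : G \in unitmx.
  rewrite -row_free_unit -kermx_eq0; apply/rowV0P => u /sub_kermxP uG.
  pose v := \sum_i u 0 i *: e`_i.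
  have vv : f v v = 0.
    rewrite {2}/v linear_sumr big1 // => j _; rewrite linearZr_LR /=.
    rewrite /v linear_sumlz /=; apply/eqP; rewrite mulf_eq0; apply/orP; right.
    move/matrixP/(_ 0 j): uG; rewrite !mxE => uG; apply/eqP; rewrite -[RHS]uG.
    by apply: eq_bigr => i _; rewrite linearZl_LR !mxE.
  have v0 := inner_eq0 vv.
  have /freeP fe : free e by apply: basis_free (vbasisP _).
  by apply/rowP => i; rewrite mxE; apply: fe.
pose y w : 'cV[K]_(\dim {:V}) := \col_i g (a e`_i) w.
pose b w := \sum_i sconj ((invmx G *m y w) i 0) *: e`_i.
have b_lin : linear b.
  move=> c u v; rewrite /b scaler_sumr -big_split; apply: eq_bigr => i _ /=.
  have -> : y (c *: u + v) = sconj c *: y u + y v.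
    by apply/colP => j; rewrite !mxE linearPr.
  by rewrite mulmxDr -scalemxAr !mxE rmorphD rmorphM /= sconjK scalerDl scalerA.
pose b' := GRing.isLinear.Build K W V _ b b_lin.
pose bL : {linear W -> V} := HB.pack b b'.
exists (linfun bL) => v w; rewrite lfunE /= {1 2}[v]eP linear_sum !linear_sumlz.
apply: eq_bigr => i _ /=; rewrite linearZ !linearZl_LR /=; congr (_ * _).
rewrite /b linear_sumr /=.
under eq_bigr do rewrite linearZr_LR /= sconjK.
have /colP/(_ i) : G *m (invmx G *m y w) = y w by rewrite mulKVmx.
by rewrite !mxE => <-; apply: eq_bigr => j _; rewrite !mxE mulrC.
Qed.

Lemma adjointE a v w : g (a v) w = f v (adjoint a w).
Proof. exact: (xgetPex 0 (adjoint_ex a)). Qed.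

End Adjoint.

Definition oproj (V : vectType K) (f : inner R F V) (U : {vspace V}) : 'End(V) :=
  daddv_pi U (orthov f U).

Lemma oprojP (V : vectType K) (f : inner R F V) (U : {vspace V}) v :
  oproj f U v \in U /\ v - oproj f U v \in orthov f U.
Proof.
split; first exact: memv_pi.
have UU0 : (U :&: orthov f U = 0)%VS.
  apply/eqP; rewrite -subv0; apply/subvP => u; rewrite memv_cap memv0.
  by move=> /andP[uU /mem_orthovP/(_ _ uU)/inner_eq0->].
pose i := linfun (vsval : subvs_of U -> V).
pose p := vsval (adjoint (inner_sub f U) f i v).
have pU : p \in U by exact: subvsP.
have vpU : v - p \in orthov f U.
  apply/mem_orthovP => u uU.
  have fup : f u v = f u p.
    have iu : u = i (Subvs uU) by rewrite lfunE.
    by rewrite [in LHS]iu (adjointE (inner_sub f U)).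
  have fu0 : f u (v - p) = 0 by rewrite linearBr /= fup subrr.
  by rewrite [LHS](innerC f) fu0 rmorph0.
rewrite -[v in oproj f U v](subrK p) linearD /=.
have -> : oproj f U (v - p) = 0.
  rewrite /oproj; have := daddv_pi_add (w := v - p) UU0.
  rewrite (subvP (addvSr _ _)) // => /(_ isT).
  rewrite (daddv_pi_id (U := orthov f U)) 1?capvC //.
  by move/(canRL (addrK _)); rewrite subrr.
by rewrite add0r daddv_pi_id.
Qed.

End InnerProducts.

Definition lfun_det (K : fieldType) (V : vectType K) (a : 'End(V)) : K :=
  \det (passmx.mxof (vbasis {:V}) (vbasis {:V}) a).

(* Exterior powers, as spaces of alternating tensors: a tensor of order k on V
   is given by its k-dimensional array of coordinates in the basis
   vbasis {:V}, and u_1 /\ ... /\ u_k is the sum of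
   sgn(s) u_s(1) (x) ... (x) u_s(k) over the permutations s. *)
Section ExteriorPower.
Variables (R : realType) (F : field_kind) (V : vectType (scalars R F)) (k : nat).
Local Notation K := (scalars R F).
Local Notation index := {ffun 'I_k -> 'I_(\dim {:V})}.
Local Notation tensor := {ffun index -> K^o}.
Local Notation e := (vbasis {:V}).
Implicit Types (t : tensor) (j l : index) (s : 'S_k) (u v : 'I_k -> V).

Definition tensor_alt s t : tensor :=
  [ffun j : index => t [ffun a => j (s a)] - (-1) ^+ s * t j].

Fact tensor_alt_linear s : linear (tensor_alt s).
Proof.
move=> c t t'; apply/ffunP => j; rewrite !ffunE scalerBr !mulrDr.
by rewrite opprD addrACA /GRing.scale /= mulrCA.
Qed.
HB.instance Definition _ s :=
  GRing.isLinear.Build K tensor tensor _ (tensor_alt s) (tensor_alt_linear s).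

Definition alternating : {vspace tensor} :=
  (\bigcap_(s : 'S_k) lker (linfun (tensor_alt s)))%VS.

Lemma alternatingP t :
  reflect (forall s j, t [ffun a => j (s a)] = (-1) ^+ s * t j)
          (t \in alternating).
Proof.
apply: (iffP subv_bigcapP) => [tA s j|tA s _].
  have := tA s isT; rewrite -memvE memv_ker lfunE /= => /eqP/ffunP/(_ j).
  by rewrite !ffunE => /eqP; rewrite subr_eq0 => /eqP.
rewrite -memvE memv_ker lfunE /=; apply/eqP/ffunP => j.
by rewrite !ffunE tA subrr.
Qed.

Definition ext_power := subvs_of alternating.

Definition wedge_coord u : tensor :=
  [ffun j : index => \det (\matrix_(a, b) coord e (j b) (u a))].

Lemma wedge_coordE u j :
  wedge_coord u j = \sum_(s : 'S_k) (-1) ^+ s * \prod_i coord e (j i) (u (s i)).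
Proof.
rewrite ffunE -det_tr; apply: eq_bigr => s _; congr (_ * _).
by apply: eq_bigr => i _; rewrite !mxE.
Qed.

Fact wedge_subproof u : wedge_coord u \in alternating.
Proof.
apply/alternatingP => s j; rewrite !ffunE -det_tr.
rewrite -[\det (\matrix_(a, b) _ (j b) _)]det_tr -det_perm -det_mulmx.
congr (\det _); apply/matrixP => a b; rewrite -row_permE !mxE ffunE.
by [].
Qed.

Definition wedge u : ext_power := Subvs (wedge_subproof u).

(* The restriction to alternating tensors of the k-th tensor power of a. *)
Definition ext_map_coord (a : 'End(V)) t : tensor :=
  [ffun l : index =>
     \sum_(j : index) t j * \prod_(i < k) coord e (l i) (a e`_(j i))].

Fact ext_map_subproof a (t : ext_power) :
  ext_map_coord a (vsval t) \in alternating.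
Proof.
apply/alternatingP => s l; rewrite !ffunE mulr_sumr.
pose h s (j : index) : index := [ffun i => j (s i)].
have hK : cancel (h s) (h s^-1%g).
  by move=> j; apply/ffunP => i; rewrite !ffunE permKV.
have hK' : cancel (h s^-1%g) (h s).
  by move=> j; apply/ffunP => i; rewrite !ffunE permK.
rewrite (reindex (h s)); last by exists (h s^-1%g) => j _; [exact: hK|exact: hK'].
apply: eq_bigr => j _; have /alternatingP -> := subvsP t; rewrite -mulrA.
congr (_ * (_ * _)); rewrite [RHS](reindex_inj (@perm_inj _ s)).
by apply: eq_bigr => i _; rewrite !ffunE.
Qed.

Definition ext_map (a : 'End(V)) (t : ext_power) : ext_power :=
  Subvs (ext_map_subproof a t).

Lemma ext_map_wedge a u : ext_map a (wedge u) = wedge (fun i => a (u i)).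
Proof.
apply: val_inj; apply/ffunP => l; rewrite !ffunE /=.
rewrite -[RHS]det_tr /determinant.
transitivity (\sum_(j : index) \sum_(s : 'S_k) (-1) ^+ s *
    \prod_i (coord e (j i) (u (s i)) * coord e (l i) (a e`_(j i)))).
  apply: eq_bigr => j _; rewrite wedge_coordE mulr_suml.
  by apply: eq_bigr => s _; rewrite -mulrA big_split.
rewrite exchange_big; apply: eq_bigr => s _ /=.
rewrite -mulr_sumr; congr (_ * _).
pose G i (j : 'I_(\dim {:V})) := coord e j (u (s i)) * coord e (l i) (a e`_j).
rewrite -(bigA_distr_bigA G); apply: eq_bigr => i _; rewrite !mxE.
rewrite [in RHS](coord_vbasis (memvf (u (s i)))) linear_sum linear_sum.
by apply: eq_bigr => j _; rewrite !linearZ.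
Qed.

(* The factor 1/k! turns the tensor inner product into the one of
   ext_inner_wedge. *)
Definition ext_inner (f : inner R F V) (t t' : ext_power) : K :=
  (k`!%:R)^-1 * \sum_(j : index) \sum_(l : index)
    vsval t j * sconj (vsval t' l) * \prod_(i < k) f e`_(j i) e`_(l i).

Lemma ext_inner_wedge f u v :
  ext_inner f (wedge u) (wedge v) = \det (\matrix_(i, j) f (u i) (v j)).
Proof.
have fE x y : f x y = \sum_i \sum_j coord e i x * sconj (coord e j y) * f e`_i e`_j.
  rewrite {1}(coord_vbasis (memvf x)) linear_sumlz; apply: eq_bigr => i _.
  rewrite linearZl_LR {1}(coord_vbasis (memvf y)) linear_sumr mulr_sumr.
  by apply: eq_bigr => j _; rewrite linearZr_LR /= mulrA.
rewrite /ext_inner.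
pose P s s' := \prod_i f (u (s i)) (v (s' i)) : K.
transitivity ((k`!%:R)^-1 *
    \sum_(s : 'S_k) \sum_(s' : 'S_k) (-1) ^+ s * (-1) ^+ s' * P s s').
  congr (_ * _).
  transitivity (\sum_(j : index) \sum_(l : index) \sum_(s : 'S_k) \sum_(s' : 'S_k)
     (-1) ^+ s * (-1) ^+ s' * \prod_i (coord e (j i) (u (s i)) *
        sconj (coord e (l i) (v (s' i))) * f e`_(j i) e`_(l i))).
    apply: eq_bigr => j _; apply: eq_bigr => l _.
    rewrite /= !wedge_coordE rmorph_sum -mulrA mulr_suml; apply: eq_bigr => s _.
    rewrite mulr_suml mulr_sumr; apply: eq_bigr => s' _.
    rewrite rmorphM rmorphXn rmorphN1 rmorph_prod !big_split /=.
    by rewrite -!mulrA; congr (_ * _); rewrite [LHS]mulrCA.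
  under eq_bigr do rewrite exchange_big.
  rewrite exchange_big; apply: eq_bigr => s _ /=.
  under eq_bigr do rewrite exchange_big.
  rewrite exchange_big; apply: eq_bigr => s' _ /=.
  under eq_bigr do rewrite -mulr_sumr.
  rewrite -mulr_sumr; congr (_ * _); rewrite /P.
  under [RHS]eq_bigr do rewrite fE.
  rewrite bigA_distr_bigA; apply: eq_bigr => j _ /=.
  by rewrite bigA_distr_bigA.
suff inner_sum s :
    \sum_(s' : 'S_k) (-1) ^+ s * (-1) ^+ s' * P s s'
    = \det (\matrix_(i, j) f (u i) (v j)).
  under eq_bigr do rewrite inner_sum.
  rewrite sumr_const -[X in _ * X]mulr_natl card_Sn mulrA mulVf ?mul1r//.
  by rewrite pnatr_eq0 -lt0n fact_gt0.
rewrite /determinant (reindex_inj (mulgI s)); apply: eq_bigr => s' _ /=.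
rewrite odd_permM signr_addb mulrA -signr_addb addbb mul1r; congr (_ * _).
rewrite [RHS](reindex_inj (@perm_inj _ s)); apply: eq_bigr => i _.
by rewrite !mxE permM.
Qed.

End ExteriorPower.

Record graph := Graph {
  vertex : finType;
  edge : finType;
  source : edge -> vertex;
  target : edge -> vertex;
  inv : edge -> edge;
  pos_edges : {set edge};
  invK : involutive inv;
  inv_neq : forall e, inv e != e;
  source_inv : forall e, source (inv e) = target e;
  pos_edges_inv : forall e, (inv e \in pos_edges) = (e \notin pos_edges)
}.

Arguments source {g} e.
Arguments target {g} e.
Arguments inv {g} e.

Lemma target_inv (G : graph) (e : edge G) : target (inv e) = source e.
Proof. by rewrite -source_inv invK. Qed.

Section Combinatorics.
Variable G : graph.
Implicit Types (S : {set edge G}) (p : seq (edge G)).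

Definition subgraph S := [forall e in S, inv e \in S].

Definition adjacent S : rel (vertex G) :=
  fun u v => [exists e in S, (source e == u) && (target e == v)].

Definition connected S :=
  (0 < #|vertex G|)%N && [forall u, forall v, connect (adjacent S) u v].

(* The condition f != inv e only matters for circuits of length 1 and 2. *)
Definition circuit p :=
  [&& p != [::],
      cycle (fun e f => (target e == source f) && (f != inv e)) p
    & uniq [seq source e | e <- p]].

Definition acyclic S := forall p, circuit p -> ~ {subset p <= S}.

Definition spanning_trees : {set {set edge G}} :=
  [set T | [&& subgraph T, connected T & `[< acyclic T >]]].

(* {ffun I -> int} is used as the free abelian group on I, with basis gen. *)
Definition gen (I : finType) (i : I) : {ffun I -> int} := [ffun j => (j == i)%:R].

Definition edge_relations : {pred {ffun edge G -> int}} :=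
  fun c => `[< exists a : edge G -> int,
                 c = \sum_e (gen e + gen (inv e)) *~ a e >].

Fact edge_relations_zmod : zmod_closed edge_relations.
Proof.
split=> [|c c' /asboolP[a ->] /asboolP[a' ->]]; apply/asboolP.
  by exists (fun=> 0); rewrite big1.
by exists (fun e => a e - a' e); rewrite -sumrB; apply: eq_bigr => e _; rewrite mulrzBr.
Qed.
HB.instance Definition _ :=
  GRing.isZmodClosed.Build {ffun edge G -> int} edge_relations edge_relations_zmod.

Definition C1 := Quotient.quot (edge_relations : zmodClosed _).
HB.instance Definition _ := GRing.Zmodule.on C1.
HB.instance Definition _ := ZmodQuotient.on C1.

Definition to_C1 (c : {ffun edge G -> int}) : C1 := \pi_C1 c.

Fact to_C1_zmod : zmod_morphism to_C1.
Proof. exact: (@raddfB _ _ \pi_C1). Qed.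
HB.instance Definition _ :=
  GRing.isZmodMorphism.Build {ffun edge G -> int} C1 to_C1 to_C1_zmod.


Definition edge_chain (e : edge G) : C1 := to_C1 (gen e).

Lemma to_C1K (c : C1) : to_C1 (repr c) = c.
Proof. exact: reprK. Qed.

(* The homomorphism C1 -> A that sends edge_chain e to h e, provided that
   h (inv e) = - h e. *)
Definition chain_lift (A : zmodType) (h : edge G -> A) (c : C1) : A :=
  \sum_e h e *~ (repr c : {ffun edge G -> int}) e.

Lemma edge_chain_inv e : edge_chain (inv e) = - edge_chain e.
Proof.
have pi0 : to_C1 (gen e + gen (inv e)) = to_C1 0.
  apply/eqP; rewrite /to_C1 -Quotient.idealrBE subr0; apply/asboolP.
  exists (fun f => (f == e)%:R); rewrite (bigD1 e) //= eqxx mulr1z big1 ?addr0//.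
  by move=> f /negPf->; rewrite mulr0z.
by apply/eqP; rewrite -addr_eq0 addrC; apply/eqP; rewrite -[LHS](raddfD to_C1) [LHS]pi0 raddf0.
Qed.

Lemma pi_gen_sum (c : {ffun edge G -> int}) :
  to_C1 c = \sum_e edge_chain e *~ c e.
Proof.
rewrite {1}(_ : c = \sum_e gen e *~ c e) ?raddf_sum; last first.
  apply/ffunP => f; rewrite sum_ffunE (bigD1 f) //= big1 => [|e ef].
    by rewrite ffunMzE ffunE eqxx addr0 intz.
  by rewrite ffunMzE ffunE eq_sym (negPf ef) mul0rz.
by apply: eq_bigr => e _; rewrite raddfMz.
Qed.

Section ChainLift.
Variables (A : zmodType) (h : edge G -> A).
Hypothesis h_inv : forall e, h (inv e) = - h e.

Lemma chain_lift_pi (c : {ffun edge G -> int}) :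
  chain_lift h (to_C1 c) = \sum_e h e *~ c e.
Proof.
pose L (c : {ffun edge G -> int}) := \sum_e h e *~ c e.
have L_zmod : zmod_morphism L.
  move=> x y; rewrite -sumrB; apply: eq_bigr => e _.
  by rewrite !ffunE mulrzBr.
pose La : {additive _ -> _} :=
  HB.pack L (GRing.isZmodMorphism.Build _ _ L L_zmod).
have LaE x : L x = La x by [].
have Lgen e : La (gen e) = h e.
  rewrite -LaE /L (bigD1 e) //= big1 => [|f fe]; rewrite ffunE.
    by rewrite eqxx addr0.
  by rewrite (negPf fe).
apply/eqP; rewrite -subr_eq0 -[_ - _]/(La _ - La _) -raddfB.
have : repr (to_C1 c) - c \in edge_relations.
  by rewrite Quotient.idealrBE /to_C1 reprK.
move=> /asboolP[a ->]; rewrite raddf_sum big1 // => e _.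
by rewrite raddfMz raddfD !Lgen h_inv subrr mul0rz.
Qed.

Lemma chain_lift_zmod : zmod_morphism (chain_lift h).
Proof.
move=> x y; rewrite -[x]to_C1K -[y]to_C1K -(raddfB to_C1) !chain_lift_pi -sumrB.
by apply: eq_bigr => e _; rewrite !ffunE mulrzBr.
Qed.

Lemma chain_lift_edge e : chain_lift h (edge_chain e) = h e.
Proof.
rewrite chain_lift_pi (bigD1 e) //= big1 => [|f fe]; rewrite ffunE.
  by rewrite eqxx addr0.
by rewrite (negPf fe).
Qed.

End ChainLift.

Lemma chain_lift_unique (A : zmodType) (f : {additive C1 -> A}) c :
  f c = chain_lift (f \o edge_chain) c.
Proof.
rewrite -[c]to_C1K pi_gen_sum raddf_sum -pi_gen_sum to_C1K.
by apply: eq_bigr => e _; rewrite raddfMz.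
Qed.

Definition boundary : C1 -> {ffun vertex G -> int} :=
  chain_lift (fun e => gen (target e) - gen (source e)).

Lemma boundary_edge e : boundary (edge_chain e) = gen (target e) - gen (source e).
Proof.
by apply: chain_lift_edge => f; rewrite source_inv target_inv opprB.
Qed.

Definition chains_on S (c : C1) :=
  exists a : edge G -> int, c = \sum_(e in S) edge_chain e *~ a e.

Definition Z1 S (c : C1) := chains_on S c /\ boundary c = 0.

Definition Z_basis (P : C1 -> Prop) k (z : 'I_k -> C1) :=
  (forall j, P (z j)) /\
  (forall c, P c -> exists! a : {ffun 'I_k -> int}, c = \sum_j z j *~ a j).

(* As S is a graph, H_1(S) = Z_1(S), which is a free abelian group. *)
Definition betti1_is S k := exists z : 'I_k -> C1, Z_basis (Z1 S) z.

Definition connected_subgraphs k : {set {set edge G}} :=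
  [set S | [&& subgraph S, connected S & `[< betti1_is S k >]]].

End Combinatorics.

Section Forms.
Variables (R : realType) (F : field_kind) (G : graph).
Local Notation K := (scalars R F).

Definition Omega0 := {ffun vertex G -> K^o}.
HB.instance Definition _ := Vector.on Omega0.

Definition inner0 : inner R F Omega0 := inner_std R F (vertex G).

(* Hom(C1 G, K): a homomorphism is given by its values on the edges. *)
Definition odd_defect (a : {ffun edge G -> K^o}) : {ffun edge G -> K^o} :=
  [ffun e => a e + a (inv e)].

Fact odd_defect_linear : linear odd_defect.
Proof. by move=> c a b; apply/ffunP => e; rewrite !ffunE scalerDr addrACA. Qed.
HB.instance Definition _ :=
  GRing.isLinear.Build K _ _ _ odd_defect odd_defect_linear.

Definition odd_functions : {vspace {ffun edge G -> K^o}} := lker (linfun odd_defect).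

Definition Omega1 := subvs_of odd_functions.
HB.instance Definition _ := Vector.on Omega1.

Definition on_edge (a : Omega1) (e : edge G) : K := vsval a e.

Lemma odd_functionsP (a : {ffun edge G -> K^o}) :
  reflect (forall e, a (inv e) = - a e) (a \in odd_functions).
Proof.
rewrite memv_ker lfunE /=; apply: (iffP eqP) => [/ffunP a0 e|aN].
  by have := a0 e; rewrite !ffunE addrC => /eqP; rewrite addr_eq0 => /eqP.
by apply/ffunP => e; rewrite !ffunE aN subrr.
Qed.

Definition on_chain (a : Omega1) : C1 G -> K := chain_lift (on_edge a).

Lemma on_edge_inv a e : on_edge a (inv e) = - on_edge a e.
Proof. exact: (odd_functionsP _ (subvsP a)). Qed.

Lemma on_chain_edge a e : on_chain a (edge_chain e) = on_edge a e.
Proof. exact: chain_lift_edge (on_edge_inv a) _. Qed.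

Lemma on_chain_zmod a : zmod_morphism (on_chain a).
Proof. exact: chain_lift_zmod (on_edge_inv a). Qed.

Lemma on_edge_inj a b : on_edge a =1 on_edge b -> a = b.
Proof. by move=> ab; apply/val_inj/ffunP. Qed.

Lemma Omega1_hom (h : {additive C1 G -> K}) :
  exists! a : Omega1, forall c, on_chain a c = h c.
Proof.
have hA : [ffun e => h (edge_chain e) : K^o] \in odd_functions.
  by apply/odd_functionsP => e; rewrite !ffunE edge_chain_inv raddfN.
exists (Subvs hA); split=> [c|b bh].
  rewrite chain_lift_unique; apply: eq_bigr => e _.
  by rewrite /on_edge /= ffunE.
apply: on_edge_inj => e.
by rewrite /on_edge /= ffunE -bh on_chain_edge.
Qed.

Fact d_subproof (f : Omega0) :
  [ffun e => f (target e) - f (source e) : K^o] \in odd_functions.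
Proof.
by apply/odd_functionsP => e; rewrite !ffunE source_inv target_inv opprB.
Qed.

Definition d_fun (f : Omega0) : Omega1 := Subvs (d_subproof f).

Fact d_fun_linear : linear d_fun.
Proof.
move=> c f g; apply: on_edge_inj => e.
by rewrite /on_edge /= !ffunE scalerBr opprD addrACA.
Qed.
HB.instance Definition _ := GRing.isLinear.Build K _ _ _ d_fun d_fun_linear.

Definition d : 'Hom(Omega0, Omega1) := linfun d_fun.

Lemma dE f e : on_edge (d f) e = f (target e) - f (source e).
Proof. by rewrite lfunE /on_edge /= ffunE. Qed.

(* For F = ComplexScalars, 0 < z says that z is a positive real number. *)
Record weights := Weights {
  weight :> edge G -> K;
  weight_gt0 : forall e, 0 < weight e;
  weight_inv : forall e, weight (inv e) = weight e
}.

Variable x : weights.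

Definition weight_set (A : {set edge G}) : K :=
  \prod_(e in (A :|: inv @: A) :&: pos_edges G) x e.

Section Inner1.
Implicit Types a b c : Omega1.

Definition form1 a b : K :=
  \sum_(e in pos_edges G) x e * (on_edge a e * sconj (on_edge b e)).

Fact form1_lin w z a b : form1 (z *: a + b) w = z * form1 a w + form1 b w.
Proof.
rewrite /form1 mulr_sumr -big_split; apply: eq_bigr => e _ /=.
have -> : on_edge (z *: a + b) e = z * on_edge a e + on_edge b e.
  by rewrite /on_edge /= !ffunE.
by rewrite mulrDl mulrDr -[z * _ * _]mulrA [x e * (z * _)]mulrCA.
Qed.

Fact form1_conj a b : form1 a b = sconj (form1 b a).
Proof.
rewrite /form1 rmorph_sum; apply: eq_bigr => e _ /=.
by rewrite !rmorphM /= sconjK (sconj_pos (weight_gt0 x e)) [_ * on_edge a e]mulrC.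
Qed.

Fact form1_pos a : a != 0 -> 0 < form1 a a.
Proof.
move=> a0; have ge0 e : 0 <= x e * (on_edge a e * sconj (on_edge a e)).
  by rewrite mul_sconj mulr_ge0 ?exprn_ge0 // ltW // weight_gt0.
rewrite lt_def sumr_ge0 // andbT; apply: contraNneq a0 => /eqP.
rewrite psumr_eq0 // => /allP a_eq0.
have ap e : e \in pos_edges G -> on_edge a e = 0.
  move=> ep; have := a_eq0 e (mem_index_enum _); rewrite ep mul_sconj.
  by rewrite mulf_eq0 (gt_eqF (weight_gt0 x e)) sqrf_eq0 normr_eq0 => /eqP.
apply/eqP; apply: on_edge_inj => e; rewrite [RHS]ffunE.
have [/ap//|en] := boolP (e \in pos_edges G).
by rewrite -[e]invK on_edge_inv ap ?oppr0 // pos_edges_inv.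
Qed.

Definition inner1 : inner R F Omega1 := mk_inner form1_lin form1_conj form1_pos.
End Inner1.

Definition dstar : 'Hom(Omega1, Omega0) := adjoint inner0 inner1 d.

Section Extension.
Variables (k : nat) (theta : k.-tuple Omega1).

Definition inner_domain :
    inner R F (subvs_of (orthov inner0 (lker d)) * {ffun 'I_k -> K^o})%type :=
  inner_sum (inner_sub inner0 (orthov inner0 (lker d))) (inner_std R F 'I_k).

Definition omega_fun (t : {ffun 'I_k -> K^o}) : Omega1 :=
  \sum_(i < k) t i *: tnth theta i.

Fact omega_fun_linear : linear omega_fun.
Proof.
move=> c t t'; rewrite /omega_fun scaler_sumr -big_split; apply: eq_bigr => i _ /=.
by rewrite !ffunE scalerDl scalerA.
Qed.
HB.instance Definition _ :=
  GRing.isLinear.Build K _ _ _ omega_fun omega_fun_linear.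

Definition omega : 'Hom({ffun 'I_k -> K^o}, Omega1) := linfun omega_fun.

Definition d_omega_fun
    (u : subvs_of (orthov inner0 (lker d)) * {ffun 'I_k -> K^o}) : Omega1 :=
  d (vsval u.1) + omega u.2.

Fact d_omega_fun_linear : linear d_omega_fun.
Proof. by move=> c u v; rewrite /d_omega_fun /= !linearP /= scalerDr addrACA. Qed.
HB.instance Definition _ :=
  GRing.isLinear.Build K _ _ _ d_omega_fun d_omega_fun_linear.

Definition d_omega :
    'Hom((subvs_of (orthov inner0 (lker d)) * {ffun 'I_k -> K^o})%type, Omega1) :=
  linfun d_omega_fun.

Definition Delta :
    'End((subvs_of (orthov inner0 (lker d)) * {ffun 'I_k -> K^o})%type) :=
  (adjoint inner_domain inner1 d_omega \o d_omega)%VF.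

End Extension.
End Forms.

(* Main.v *)
(** Fix a root r. Everything equals the Gram determinant of the family formed by
    the differentials of the indicators of the n = |V| - 1 other vertices and
    by theta_1, ..., theta_k.
    - Cauchy-Binet writes it as a sum over the sets A of n + k positive edges.
      If the graph spanned by A is connected, preimages of the v - r under the
      boundary and a Z-basis of the cycles form a unimodular basis of the
      chains, in which the minor becomes block triangular and equals, up to
      sign, det (theta_i (z_j)); otherwise the indicator of a component
      makes it vanish. For k = 0 this is the matrix-tree theorem.
    - Replacing theta_i by its projection on ker d* is a unitriangular
      change of family, after which the Gram matrix is block diagonal.
    - det (a^* a) is the quotient of the Gram determinants of (a u_i) and (u_i);
      for the projections of the indicators on (ker d)^perp the latter is
      1 / |V|. *)

From HB Require Import structures.
Require Import Defs.
From mathcomp Require Import fingroup perm.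
From mathcomp Require Import all_boot all_order all_algebra.
From mathcomp Require Import complex.
From mathcomp Require Import boolp classical_sets reals.

Set Implicit Arguments.
Unset Strict Implicit.
Unset Printing Implicit Defensive.

Import Order.TTheory GRing.Theory Num.Theory.
Local Open Scope ring_scope.

(** * Two determinant identities over commutative rings and fields *)

(** Two triangular factorizations of one block matrix have the same determinant. With n = 1 this
    evaluates the determinant of a rank one perturbation of the identity, as in
    [det_gram_domain]. *)
Lemma det_1B_mulC (A : comPzRingType) m n (B : 'M[A]_(m, n)) (C : 'M[A]_(n, m)) :
  \det (1%:M - B *m C) = \det (1%:M - C *m B).
Proof.
have E1 : block_mx 1%:M B C 1%:M
    = block_mx 1%:M 0 C 1%:M *m block_mx 1%:M B 0 (1%:M - C *m B).
  by rewrite mulmx_block !mul1mx !mul0mx !mulmx1 ?mulmx0 !addr0 subrKC.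
have E2 : block_mx 1%:M B C 1%:M
    = block_mx (1%:M - B *m C) B 0 1%:M *m block_mx 1%:M 0 C 1%:M.
  by rewrite mulmx_block !mul1mx !mul0mx !mulmx1 ?mulmx0 !add0r subrK.
have := congr1 determinant E1; rewrite {1}E2 !det_mulmx !det_lblock !det_ublock.
by rewrite !det1 !mulr1 !mul1r.
Qed.

(* Leibniz-expand both determinants over all functions 'I_N -> I; those with a
   given N-element image contribute N! times the same product of minors. *)
Lemma cauchy_binet (K : numFieldType) (I : finType) N (a b : 'I_N -> I -> K)
    (H : {set I} -> K) :
  (forall f : 'I_N -> I, injective f ->
     \det (\matrix_(i, j) a i (f j)) * \det (\matrix_(i, j) b i (f j))
       = H [set f j | j in 'I_N]) ->
  \det (\matrix_(i, j) \sum_e a i e * b j e) = \sum_(A : {set I} | #|A| == N) H A.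
Proof.
move=> HE.
pose da (f : {ffun 'I_N -> I}) := \det (\matrix_(i, j) a i (f j)).
pose db (f : {ffun 'I_N -> I}) := \det (\matrix_(i, j) b i (f j)).
have E1 : \det (\matrix_(i, j) \sum_e a i e * b j e)
    = \sum_(f : {ffun 'I_N -> I}) da f * \prod_i b i (f i).
  rewrite -det_tr /determinant.
  under eq_bigr => s _.
    under eq_bigr do rewrite !mxE.
    rewrite bigA_distr_bigA mulr_sumr.
    over.
  rewrite exchange_big; apply: eq_bigr => f _ /=.
  rewrite /da -det_tr /determinant mulr_suml; apply: eq_bigr => s _.
  by rewrite big_split mulrA; do 2![congr (_ * _)]; apply: eq_bigr => i _; rewrite !mxE.
have da_perm (f : {ffun 'I_N -> I}) (s : 'S_N) : da [ffun i => f (s i)] = (-1) ^+ s * da f.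
  rewrite /da -det_perm -[\det (\matrix_(i, j) a i (f j))]det_tr -det_mulmx.
  rewrite -det_tr -row_permE; congr (\det _); apply/matrixP => i j.
  by rewrite !mxE ffunE.
have E2 : (N`!)%:R * \det (\matrix_(i, j) \sum_e a i e * b j e)
    = \sum_(f : {ffun 'I_N -> I}) da f * db f.
  (* [E1] is written once per permutation s and reindexed by f o s; the sign that [da] then picks up
     is the one of the Leibniz expansion of [db f]. *)
  transitivity (\sum_(s : 'S_N) \sum_(f : {ffun 'I_N -> I})
      da [ffun i => f (s i)] * \prod_i b i (f (s i))).
    rewrite -card_Sn mulr_natl -sumr_const; apply: eq_bigr => s _.
    pose h (f : {ffun 'I_N -> I}) := [ffun i => f (s i)].
    rewrite E1 (reindex h) /=; last first.
      exists (fun f : {ffun 'I_N -> I} => [ffun i => f ((s^-1)%g i)]) => f _;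
        by apply/ffunP => i; rewrite !ffunE ?permK ?permKV.
    by apply: eq_bigr => f _; congr (_ * _); apply: eq_bigr => i _; rewrite ffunE.
  rewrite exchange_big; apply: eq_bigr => f _ /=.
  rewrite /db /determinant mulr_sumr; apply: eq_bigr => s _.
  rewrite da_perm mulrCA mulrA; congr (_ * _).
  by apply: eq_bigr => i _; rewrite !mxE.
have inj0 (f : {ffun 'I_N -> I}) : ~~ injectiveb f -> da f = 0.
  case/injectivePn => i [j ij fij]; rewrite /da -det_tr.
  by apply: determinant_alternate ij _ => l; rewrite !mxE fij.
have N0 : (N`!)%:R != 0 :> K by rewrite pnatr_eq0 -lt0n fact_gt0.
apply: (mulfI N0); rewrite E2 (bigID (fun f : {ffun 'I_N -> I} => injectiveb f)) /=.
rewrite [X in _ + X]big1 ?addr0; last by move=> f /inj0 ->; rewrite mul0r.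
rewrite (partition_big (fun f : {ffun 'I_N -> I} => [set f j | j in 'I_N])
           (fun A : {set I} => #|A| == N)) /=; last first.
  by move=> f /injectiveP fi; rewrite card_imset // card_ord.
rewrite mulr_sumr; apply: eq_bigr => A /eqP cA.
rewrite (eq_bigr (fun=> H A)); last first.
  by move=> f /andP[/injectiveP fi /eqP <-]; rewrite -HE.
rewrite sumr_const mulr_natl; congr (_ *+ _).
have := @card_inj_ffuns_on 'I_N I (mem A); rewrite cA card_ord ffactnn => <-.
rewrite -sum1dep_card -sum1_card; apply: eq_bigl => f; rewrite unfold_in /= andbC.
case: (boolP (injectiveb f)) => fi; rewrite ?andbF // !andbT.
apply/eqP/ffun_onP => [<- j|fA]; first by apply: imset_f.
apply/eqP; rewrite eqEcard cA card_imset ?card_ord ?leqnn ?andbT; last exact/injectiveP.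
by apply/fintype.subsetP => _ /imsetP[j _ ->]; apply: fA.
Qed.

(** * Gram matrices under linear changes of families and under adjoints *)

Section Gram.
Variables (R : realType) (F : field_kind).
Local Notation K := (scalars R F).

Definition gram (V : vectType K) (g : inner R F V) m (u : 'I_m -> V) : 'M[K]_m :=
  \matrix_(i, j) g (u i) (u j).

Lemma gram_lin (V : vectType K) (g : inner R F V) m p (P : 'M[K]_(m, p))
    (u : 'I_p -> V) (v : 'I_m -> V) :
  (forall i, v i = \sum_j P i j *: u j) ->
  gram g v = P *m gram g u *m (map_mx sconj P)^T.
Proof.
move=> vE; apply/matrixP => i j; rewrite !mxE !vE linear_sumr.
apply: eq_bigr => l _; rewrite linear_sumlz !mxE /= mulr_suml.
apply: eq_bigr => l' _; rewrite linearZl_LR linearZr_LR !mxE /=.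
by rewrite mulrCA mulrC.
Qed.

Lemma det_gram_unitriangular (V : vectType K) (g : inner R F V) m
    (P : 'M[K]_m) (u v : 'I_m -> V) :
  (forall i, v i = \sum_j P i j *: u j) -> \det P = 1 ->
  \det (gram g v) = \det (gram g u).
Proof.
move=> vE P1; rewrite (gram_lin g vE) !det_mulmx det_tr det_map_mx P1.
by rewrite rmorph1 mul1r mulr1.
Qed.

(** The condition on [m] makes the coordinate matrix [P] of [u] square, so both Gram determinants
    are those of the basis case times det P and its conjugate. For the basis, multiplying its Gram
    matrix by the matrix of a^* a gives the Gram matrix of the images, by adjunction. *)
Lemma det_adjoint_comp (V W : vectType K) (f : inner R F V) (g : inner R F W)
    (a : 'Hom(V, W)) m (u : 'I_m -> V) :
  m = \dim {:V} ->
  lfun_det (adjoint f g a \o a)%VF * \det (gram f u)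
    = \det (gram g (fun i => a (u i))).
Proof.
move=> mE; subst m; rewrite /lfun_det.
pose e := vbasis {:V}; pose P : 'M[K]_(\dim {:V}) := \matrix_(i, j) coord e j (u i).
have uE i : u i = \sum_j P i j *: e`_j.
  by rewrite [LHS](coord_vbasis (memvf _)); apply: eq_bigr => j _; rewrite mxE.
have auE i : a (u i) = \sum_j P i j *: a e`_j.
  by rewrite uE linear_sum; apply: eq_bigr => j _; rewrite linearZ.
(* Row-vector convention: row i of [M] holds the coordinates of the image of e_i, hence [M] stands
   on the left of the Gram matrix. *)
set M := passmx.mxof _ _ _.
have ME : M *m gram f (fun i => e`_i) = gram g (fun i => a e`_i).
  apply/matrixP => i l; rewrite !mxE.
  transitivity (f ((adjoint f g a \o a)%VF e`_i) e`_l).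
    rewrite [X in f X _](coord_vbasis (memvf _)) linear_sumlz.
    apply: eq_bigr => j _; rewrite linearZl_LR !mxE /=; congr (coord _ _ _ * _).
    by rewrite passmx.vecof_delta.
  by rewrite lfunE /= innerC -adjointE -innerC.
rewrite (gram_lin f uE) (gram_lin g auE) -ME !det_mulmx.
by rewrite !mulrA; congr (_ * _ * _); rewrite mulrC.
Qed.

Lemma det_gram_split (V : vectType K) (g : inner R F V) m p
    (u : 'I_(m + p) -> V) :
  (forall i j, g (u (lshift p i)) (u (rshift m j)) = 0) ->
  \det (gram g u) = \det (gram g (fun i => u (lshift p i)))
                    * \det (gram g (fun j => u (rshift m j))).
Proof.
move=> u0; rewrite -[gram g u]submxK.
have -> : ursubmx (gram g u) = 0 by apply/matrixP => i j; rewrite !mxE u0.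
by rewrite det_lblock; congr (_ * _); congr (\det _); apply/matrixP => i j; rewrite !mxE.
Qed.

End Gram.

(** * Integral chains, boundaries and cycles of the subgraph on given edges *)

Section Cycles.
Variable G : graph.
Local Notation inv := (@Defs.inv G).
Implicit Types (A S : {set edge G}) (e : edge G).

(** Restricted to sets of positive edges, this is the inverse of intersecting a subgraph with
    [pos_edges G]. *)
Definition symcl A : {set edge G} := A :|: inv @: A.

Lemma in_symcl A e : (e \in symcl A) = (e \in A) || (inv e \in A).
Proof.
rewrite finset.in_setU; congr (_ || _); apply/imsetP/idP => [[e' e'A ->]|eA].
  by rewrite Defs.invK.
by exists (inv e) => //; rewrite Defs.invK.
Qed.

Lemma symcl_subgraph A : subgraph (symcl A).
Proof. by apply/forall_inP => e; rewrite !in_symcl Defs.invK orbC. Qed.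

Lemma adjacent_sym S : subgraph S -> symmetric (adjacent S).
Proof.
move=> /forall_inP sS; suff H u v : adjacent S u v -> adjacent S v u.
  by move=> u v; apply/idP/idP; apply: H.
case/exists_inP => e eS /andP[/eqP <- /eqP <-]; apply/exists_inP; exists (inv e).
  exact: sS.
by rewrite source_inv target_inv !eqxx.
Qed.

Lemma connected_root S (r : vertex G) : subgraph S ->
  (forall v, connect (adjacent S) r v) -> connected S.
Proof.
move=> sS rS; apply/andP; split; first by apply/card_gt0P; exists r.
apply/forallP => u; apply/forallP => v; apply: connect_trans (rS v).
by rewrite (sym_connect_sym (adjacent_sym sS)).
Qed.

Lemma boundary_zmod : zmod_morphism (@boundary G).
Proof. by apply: chain_lift_zmod => e; rewrite source_inv target_inv opprB. Qed.
HB.instance Definition _ :=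
  GRing.isZmodMorphism.Build (C1 G) {ffun vertex G -> int} (@boundary G) boundary_zmod.

(** The coefficient of a chain along e. The second term makes the function odd under inversion, so
    that it descends to the quotient [C1 G]. *)
Definition edge_coef e : C1 G -> int :=
  chain_lift (fun e' => (e' == e)%:R - (e' == inv e)%:R).

Lemma edge_coef_inv0 e e' : (inv e' == e)%:R - (inv e' == inv e)%:R
  = - ((e' == e)%:R - (e' == inv e)%:R) :> int.
Proof. by rewrite (inj_eq (can_inj (@Defs.invK G))) opprB (can2_eq (@Defs.invK G) (@Defs.invK G)). Qed.

Lemma edge_coef_zmod e : zmod_morphism (edge_coef e).
Proof. by apply: chain_lift_zmod => e'; exact: edge_coef_inv0. Qed.
HB.instance Definition _ e :=
  GRing.isZmodMorphism.Build (C1 G) int (edge_coef e) (edge_coef_zmod e).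

Lemma edge_coef_edge e e' :
  edge_coef e (edge_chain e') = (e' == e)%:R - (e' == inv e)%:R.
Proof. by apply: chain_lift_edge => e''; exact: edge_coef_inv0. Qed.

Lemma edge_coefN e c : edge_coef (inv e) c = - edge_coef e c.
Proof.
rewrite -[c]to_C1K; move: (repr c) => b; rewrite pi_gen_sum !(raddf_sum (edge_coef _)) -sumrN.
apply: eq_bigr => e' _ /=.
by rewrite !raddfMz /= !edge_coef_edge Defs.invK opprB.
Qed.

Section Coordinates.
Variables (N : nat) (f : 'I_N -> edge G) (r : vertex G).
Hypotheses (f_inj : injective f) (f_pos : forall j, f j \in pos_edges G).
Local Notation S := (symcl [set f j | j in 'I_N]).
Local Notation n := #|[set~ r]|.
Local Notation vv := (enum_val : 'I_n -> vertex G).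
Implicit Types (y : 'rV[int]_N) (j : 'I_N) (c : C1 G).

Definition chain_of y : C1 G := \sum_j edge_chain (f j) *~ y 0 j.

(** The reduced incidence matrix, without the column of the root; it acts on row vectors from the
    right, as the boundary does on chains. *)
Definition incidence : 'M[int]_(N, n) :=
  \matrix_(j, i) (gen (target (f j)) - gen (source (f j)) : {ffun _ -> int}) (vv i).

Lemma f_symcl j : f j \in S.
Proof. by rewrite in_symcl imset_f. Qed.

Lemma edge_symcl e : e \in S -> exists j, e = f j \/ e = inv (f j).
Proof.
rewrite in_symcl => /orP[] /imsetP[j _ E]; exists j; first by left.
by right; rewrite -E Defs.invK.
Qed.

Lemma boundary_chain_of y : boundary (chain_of y)
  = \sum_j (gen (target (f j)) - gen (source (f j))) *~ y 0 j.
Proof. by rewrite raddf_sum; apply: eq_bigr => j _; rewrite raddfMz /= boundary_edge. Qed.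

Lemma incidenceE y i : (y *m incidence) 0 i = boundary (chain_of y) (vv i).
Proof.
rewrite boundary_chain_of sum_ffunE mxE; apply: eq_bigr => j _.
by rewrite ffunMzE mxE mulrC -mulrzr intz.
Qed.

Lemma sum_boundary c : \sum_v boundary c v = 0.
Proof.
rewrite -[c]to_C1K; move: (repr c) => b.
rewrite pi_gen_sum (raddf_sum (@boundary G)).
under eq_bigr do rewrite sum_ffunE.
rewrite exchange_big big1 // => e _.
under eq_bigr do rewrite (raddfMz (@boundary G)) ffunMzE /= boundary_edge !ffunE.
rewrite -mulrz_suml.
have gen1 (w : vertex G) : \sum_v (v == w)%:R = 1 :> int.
  by rewrite (bigD1 w) //= eqxx big1 ?addr0 // => v /negPf ->.
by rewrite sumrB !gen1 subrr mul0rz.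
Qed.

Lemma vv_neq i : vv i != r.
Proof. by have := enum_valP i; rewrite finset.in_setC1. Qed.

Lemma vv_onto v : v != r -> exists i, v = vv i.
Proof.
move=> vr; have vr' : v \in [set~ r] by rewrite finset.in_setC1.
by exists (enum_rank_in vr' v); rewrite enum_rankK_in.
Qed.

(** Forgetting the root loses nothing: the coefficients of a boundary sum to 0, so the one at r is
    determined by the others. *)
Lemma incidence_eq0 y : y *m incidence = 0 <-> boundary (chain_of y) = 0.
Proof.
split=> [y0|y0]; last by apply/rowP => i; rewrite incidenceE y0 mxE ffunE.
have b0 v : v != r -> boundary (chain_of y) v = 0.
  by case/vv_onto => i ->; rewrite -incidenceE y0 mxE.
apply/ffunP => v; rewrite ffunE; have [->|/b0 //] := eqVneq v r.
have := sum_boundary (chain_of y); rewrite (bigD1 r) //= big1 ?addr0 //.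
Qed.

Lemma chain_of_zmod : zmod_morphism chain_of.
Proof.
by move=> y y'; rewrite -sumrB; apply: eq_bigr => j _; rewrite !mxE mulrzBr.
Qed.
HB.instance Definition _ :=
  GRing.isZmodMorphism.Build 'rV[int]_N (C1 G) chain_of chain_of_zmod.

Lemma chain_of_mul p (a : 'rV_p) (M : 'M_(p, N)) :
  chain_of (a *m M) = \sum_i chain_of (row i M) *~ a 0 i.
Proof.
rewrite mulmx_sum_row raddf_sum; apply: eq_bigr => i _.
by rewrite -[a 0 i in LHS]intz scaler_int raddfMz.
Qed.

(** Since the edges [f j] are distinct and all positive, none is the inverse of another and no two
    terms interfere. *)
Lemma edge_coef_chain_of j y : edge_coef (f j) (chain_of y) = y 0 j.
Proof.
rewrite raddf_sum (bigD1 j) //= big1 => [|l lj]; rewrite raddfMz /= edge_coef_edge.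
  have /negPf -> : f j != inv (f j) by rewrite eq_sym inv_neq.
  by rewrite eqxx subr0 addr0 intz.
rewrite (inj_eq f_inj) (negPf lj) (_ : f l == inv (f j) = false) ?subrr ?mul0rz//.
by apply/eqP => fl; have := f_pos l; rewrite fl pos_edges_inv f_pos.
Qed.

Lemma chain_of_inj : injective chain_of.
Proof. by move=> y y' E; apply/rowP => j; rewrite -!edge_coef_chain_of E. Qed.

Lemma chain_of_delta j : chain_of (delta_mx 0 j) = edge_chain (f j).
Proof.
rewrite /chain_of (bigD1 j) //= mxE !eqxx big1 => [|l lj]; first by rewrite addr0.
by rewrite mxE (negPf lj) andbF.
Qed.

Lemma edge_chain_of e : e \in S -> exists y, edge_chain e = chain_of y.
Proof.
case/edge_symcl => j [] ->.
  by exists (delta_mx 0 j); rewrite chain_of_delta.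
by exists (- delta_mx 0 j); rewrite raddfN /= chain_of_delta edge_chain_inv.
Qed.

Lemma chains_onP c : chains_on S c <-> exists y, c = chain_of y.
Proof.
split=> [[a ->]|[y ->]].
  elim/big_ind: _ => [|_ _ [y ->] [y' ->]|e eS].
  - by exists 0; rewrite raddf0.
  - by exists (y + y'); rewrite raddfD.
  by have [y ->] := edge_chain_of eS; exists (y *~ a e); rewrite raddfMz.
(* The coefficient at e gathers the indices that f sends to e; it is 0 at edges of [S] outside the
   image of f. *)
exists (fun e => \sum_(j | f j == e) y 0 j).
rewrite /chain_of (partition_big f (mem S)) => [|j _]; last exact: f_symcl.
apply: eq_bigr => e _ /=; rewrite mulrz_sumr.
by apply: eq_bigr => j /eqP ->.
Qed.

Lemma Z1P c : Z1 S c <-> exists2 y, c = chain_of y & y *m incidence = 0.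
Proof.
split=> [[/chains_onP[y ->] /incidence_eq0 y0]|[y -> y0]]; first by exists y.
by split; [apply/chains_onP; exists y | apply/incidence_eq0].
Qed.

(** The chain of a path from r to v, built by induction on the last edge. *)
Lemma connected_boundary v : connected S ->
  exists y, boundary (chain_of y) = gen v - gen r.
Proof.
case/andP => _ /forallP/(_ r)/forallP/(_ v)/connectP[p].
elim/last_ind: p v => [v _ ->|p u IH v].
  by exists 0; rewrite raddf0 raddf0 subrr.
rewrite rcons_path last_rcons => /andP[/IH/(_ erefl)[y yE] /exists_inP[e eS]] es vE.
have [y' y'E] := edge_chain_of eS; exists (y' + y).
case/andP: es => /eqP es /eqP et.
by rewrite raddfD raddfD /= yE -y'E boundary_edge es et vE subrKA.
Qed.

Lemma incidence_section : connected S -> exists P, P *m incidence = 1%:M.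
Proof.
move=> cS; have /fin_all_exists[Y YE] i := connected_boundary (vv i) cS.
exists (\matrix_i Y i); apply/row_matrixP => i; rewrite row_mul rowK.
apply/rowP => l; rewrite incidenceE YE !ffunE !mxE (negPf (vv_neq _)) subr0.
by rewrite (inj_eq enum_val_inj) eq_sym.
Qed.

Section Basis.
Variables (k : nat) (z : 'I_k -> C1 G) (P : 'M[int]_(n, N)).
Hypotheses (zB : Z_basis (Z1 S) z) (PD : P *m incidence = 1%:M).

Definition cycle_mx : 'M[int]_(k, N) := \matrix_(i, j) edge_coef (f j) (z i).

Lemma cycle_mxE i : z i = chain_of (row i cycle_mx).
Proof.
have [/(_ i)/Z1P[y zE _] _] := zB; rewrite zE; congr chain_of.
by apply/rowP => j; rewrite !mxE zE edge_coef_chain_of.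
Qed.

Lemma cycle_mx_incidence : cycle_mx *m incidence = 0.
Proof.
apply/row_matrixP => i; rewrite row_mul row0; apply/incidence_eq0.
by rewrite -cycle_mxE; have [/(_ i)[]] := zB.
Qed.

(* Sections of the boundary and a Z-basis of its kernel form together a Z-basis
   of the chains. *)
Lemma cycle_mx_unimodular : exists2 B : 'M[int]_(N, n + k),
  B *m col_mx P cycle_mx = 1%:M & col_mx P cycle_mx *m B = 1%:M.
Proof.
have [_ zU] := zB.
have kerE (y : 'rV_N) : y *m incidence = 0 -> exists a, y = a *m cycle_mx.
  move=> y0; have /zU[a [yE _]] : Z1 S (chain_of y) by apply/Z1P; exists y.
  exists (\row_j a j); apply: chain_of_inj; rewrite yE chain_of_mul.
  by apply: eq_bigr => i _; rewrite -cycle_mxE mxE.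
have spanE (y : 'rV_N) : exists a, y = a *m col_mx P cycle_mx.
  have /kerE[a aE] : (y - y *m incidence *m P) *m incidence = 0.
    by rewrite mulmxBl -!mulmxA PD mulmx1 subrr.
  by exists (row_mx (y *m incidence) a); rewrite mul_row_col -aE subrKC.
have free_ (a : 'rV_(n + k)) : a *m col_mx P cycle_mx = 0 -> a = 0.
  rewrite -[a]hsubmxK mul_row_col => a0.
  have l0 : lsubmx a = 0.
    have := congr1 (mulmx^~ incidence) a0; rewrite mulmxDl -!mulmxA PD.
    by rewrite cycle_mx_incidence mulmx0 addr0 mulmx1 mul0mx.
  rewrite l0 mul0mx add0r in a0 *; suff -> : rsubmx a = 0 by rewrite row_mx0.
  have /zU[b [_ bU]] : Z1 S 0.
    by apply/Z1P; exists 0; rewrite ?raddf0 ?mul0mx.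
  have <- : \row_j b j = rsubmx a.
    apply/rowP => j; rewrite (bU [ffun j => rsubmx a 0 j]) 1?[LHS]mxE ?ffunE//.
    transitivity (chain_of (rsubmx a *m cycle_mx)); first by rewrite a0 raddf0.
    by rewrite chain_of_mul; apply: eq_bigr => i _; rewrite ffunE cycle_mxE.
  have -> : b = [ffun=> 0].
    by apply: bU; rewrite big1 // => i _; rewrite ffunE.
  by apply/rowP => i; rewrite !mxE ffunE.
have /fin_all_exists[B BE] j := spanE (row j 1%:M).
have B1 : (\matrix_j B j) *m col_mx P cycle_mx = 1%:M.
  by apply/row_matrixP => j; rewrite row_mul rowK -BE.
exists (\matrix_j B j) => //; apply/eqP; rewrite -subr_eq0; apply/eqP.
apply/row_matrixP => i; rewrite row0; apply: free_.
by rewrite -row_mul mulmxBl -mulmxA B1 mulmx1 mul1mx subrr row0.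
Qed.

(** A matrix over the integers with a two-sided inverse is square. This is Euler's relation for a
    connected subgraph. *)
Lemma card_connected : N = (n + k)%N.
Proof.
have [B B1 B2] := cycle_mx_unimodular; apply/eqP.
by rewrite eqn_leq (mulmx1_min B1) (mulmx1_min B2).
Qed.

End Basis.

(* By Smith normal form the incidence matrix is, up to unimodular factors,
   diagonal; having a left inverse, it has full rank, so its kernel is spanned
   by the last k rows of a unimodular matrix. *)
Lemma betti1_connected k (P : 'M[int]_(n, N)) : P *m incidence = 1%:M ->
  N = (n + k)%N -> betti1_is S k.
Proof.
move=> PD NE.
have [L uL [Q uQ [d _ DE]]] := int_Smith_normal_form incidence.
set Dg := \matrix_(i, j) _ in DE.
have ltN (i : 'I_n) : (i < N)%N by rewrite NE ltn_addr.
pose w (i : 'I_n) := Ordinal (ltN i).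
have DgE (y : 'rV_N) i : (y *m Dg) 0 i = y 0 (w i) * d`_i.
  rewrite mxE (bigD1 (w i)) //= big1 ?addr0 ?mxE ?eqxx// => j jw.
  rewrite mxE (_ : j == i :> nat = false) ?mulr0n ?mulr0 //.
  by apply: contraNF jw => ji; apply/eqP/val_inj/eqP.
have d0 (i : 'I_n) : d`_i != 0.
  (* As Q is square, it can be moved to the front of P L Dg Q = 1; a zero d_i would then produce a
     zero column in the identity. *)
  apply/eqP => di0; have QPL : Q *m P *m L *m Dg = 1%:M.
    by rewrite DE !mulmxA in PD; have := mulmx1C PD; rewrite !mulmxA.
  have := congr1 (fun M : 'M_n => row i M 0 i) QPL.
  by rewrite row_mul DgE di0 mulr0 !mxE eqxx.
have ltNr (j : 'I_k) : (n + j < N)%N by rewrite NE ltn_add2l.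
pose t (j : 'I_k) := Ordinal (ltNr j).
pose Li := invmx L.
pose M : 'M_(k, N) := \matrix_j row (t j) Li.
have kerE (y : 'rV_N) : y *m incidence = 0 <-> forall i, (y *m L) 0 (w i) = 0.
  rewrite DE !mulmxA; split=> [y0 i|y0].
    have := congr1 (mulmx^~ (invmx Q)) y0; rewrite mulmxK // mul0mx => {}y0.
    have /eqP := DgE (y *m L) i; rewrite y0 mxE eq_sym mulf_eq0 (negPf (d0 i)) orbF.
    by move/eqP.
  rewrite (_ : y *m L *m Dg = 0) ?mul0mx //.
  by apply/rowP => i; rewrite DgE y0 mul0r mxE.
have ML i l : (M *m L) i l = (t i == l)%:R.
  transitivity ((Li *m L) (t i) l); last by rewrite mulVmx // mxE.
  by rewrite [LHS]mxE [RHS]mxE; apply: eq_bigr => l' _; rewrite !mxE.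
have aMt (a : 'rV_k) (j : 'I_k) : (a *m M *m L) 0 (t j) = a 0 j.
  rewrite -mulmxA mxE (bigD1 j) //= big1 ?addr0 ?ML ?eqxx ?mulr1 // => l lj.
  rewrite ML (_ : t l == t j = false) ?mulr0 //.
  by apply: contraNF lj; rewrite -val_eqE /= eqn_add2l val_eqE.
have aMw (a : 'rV_k) (i : 'I_n) : (a *m M *m L) 0 (w i) = 0.
  rewrite -mulmxA mxE big1 // => l _; rewrite ML (_ : t l == w i = false) ?mulr0 //.
  by apply/eqP => /(congr1 val) /= E; have := ltn_ord i; rewrite -E ltnNge leq_addr.
have sumE (a : {ffun 'I_k -> int}) :
    \sum_j chain_of (row j M) *~ a j = chain_of ((\row_j a j) *m M).
  by rewrite chain_of_mul; apply: eq_bigr => j _; rewrite mxE.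
exists (fun j : 'I_k => chain_of (row j M)); split=> [j|c /Z1P[y -> /kerE y0]].
  apply/Z1P; exists (row j M) => //; apply/kerE => i.
  by rewrite rowE aMw.
exists [ffun j : 'I_k => (y *m L) 0 (t j)]; split=> [|a].
  rewrite sumE; congr chain_of; apply: (can_inj (mulmxK uL)).
  apply/rowP => l; have [ln|nl] := ltnP l n.
    have -> : l = w (Ordinal ln) by apply: val_inj.
    by rewrite y0 aMw.
  have lk : (l - n < k)%N by rewrite ltn_subLR // -NE.
  have -> : l = t (Ordinal lk) by apply: val_inj; rewrite /= subnKC.
  by rewrite aMt [RHS]mxE ffunE.
rewrite sumE => /chain_of_inj ->; apply/ffunP => j.
by rewrite ffunE aMt [LHS]mxE.
Qed.

End Coordinates.
End Cycles.

(** * Circuits versus cycles: spanning trees are the connected subgraphs of Betti number 0 *)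

Section Trees.
Variable G : graph.
Local Notation inv := (@Defs.inv G).
Implicit Types (A S : {set edge G}) (e : edge G) (c : C1 G).

Lemma imset_enum_val A : [set enum_val j | j in 'I_#|A|] = A.
Proof.
apply/setP => e; apply/imsetP/idP => [[j _ ->]|eA]; first exact: enum_valP.
by exists (enum_rank_in eA e); rewrite ?enum_rankK_in.
Qed.

Lemma symcl_pos S : subgraph S -> symcl (S :&: pos_edges G) = S.
Proof.
move/forall_inP => sS; apply/setP => e; rewrite in_symcl !inE pos_edges_inv.
have -> : (inv e \in S) = (e \in S).
  by apply/idP/idP => /sS; rewrite ?Defs.invK.
by case: (e \in S); rewrite //= orbN.
Qed.

Lemma edge_coef_notin S e c : subgraph S -> chains_on S c -> e \notin S ->
  edge_coef e c = 0.
Proof.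
move/forall_inP => sS [a ->] eS; rewrite raddf_sum big1 // => e' e'S.
rewrite raddfMz /= edge_coef_edge; have /negPf -> : e' != e.
  by apply: contraNneq eS => <-.
rewrite (_ : e' == inv e = false) ?subrr ?mul0rz //.
by apply: contraNF eS => /eqP E; rewrite -[e]Defs.invK -E sS.
Qed.

(** An edge leaving v is counted through its inverse, which enters v and has the opposite
    coefficient. *)
Lemma boundary_vertex c v : boundary c v = \sum_(e | target e == v) edge_coef e c.
Proof.
rewrite -[c]to_C1K; move: (repr c) => b; rewrite pi_gen_sum.
rewrite (raddf_sum (@boundary G)) sum_ffunE.
under [RHS]eq_bigr do rewrite (raddf_sum (edge_coef _)) /=.
rewrite exchange_big; apply: eq_bigr => e' _ /=.
rewrite (raddfMz (@boundary G)) ffunMzE /= boundary_edge.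
under eq_bigr do rewrite (raddfMz (edge_coef _)) /= edge_coef_edge.
rewrite -mulrz_suml !ffunE; congr (_ *~ _).
rewrite sumrB; congr (_ - _).
  rewrite big_mkcond (bigD1 e') //= big1 ?addr0 ?eqxx => [|e ee'].
    by rewrite eq_sym; case: eqP.
  by rewrite [e' == e]eq_sym (negPf ee'); case: ifP.
rewrite big_mkcond (bigD1 (inv e')) //= big1 => [|e ee'].
  by rewrite target_inv Defs.invK eqxx addr0 eq_sym; case: eqP.
rewrite (_ : e' == inv e = false) ?if_same //.
by apply: contraNF ee' => /eqP ->; rewrite Defs.invK.
Qed.

Lemma map_uniq_in_inj (T T' : eqType) (h : T -> T') (p : seq T) :
  uniq (map h p) -> {in p &, injective h}.
Proof.
elim: p => //= u p IH /andP[up /IH hp] y z; rewrite !inE.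
move=> /predU1P[->|yp] /predU1P[->|zp] // E; last exact: hp.
- by rewrite E map_f in up.
- by rewrite -E map_f in up.
Qed.

(** The orbit of u in a finite type returns to an earlier point g^i(u); the tail of the orbit from
    that point on is the cycle. *)
Lemma periodic_point (T : finType) (g : T -> T) u :
  exists i p, [/\ p != [::], fcycle g p, uniq p &
                  p = traject g (iter i g u) (size p)].
Proof.
have /trajectP[i ltin E] : looping g u (order g u) by exact: looping_order.
have nE : order g u = (i + (order g u - i))%N by rewrite subnKC // ltnW.
have := orbit_uniq g u; rewrite /orbit nE trajectD cat_uniq => /and3P[_ _ Up].
move: E; rewrite {1}nE addnC iterD; case: (order g u - i)%N Up nE => [|m] Up nE E.
  by move: ltin; rewrite nE addn0 ltnn.
exists i, (traject g (iter i g u) m.+1); split; rewrite ?size_traject //.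
rewrite /cycle /= -[X in rcons _ X]E iterSr -trajectSr.
exact: fpath_traject.
Qed.

(** The sum telescopes along the path and closes up at the first edge. *)
Lemma circuit_boundary (p : seq (edge G)) : circuit p ->
  \sum_(e <- p) (gen (target e) - gen (source e)) = 0 :> {ffun vertex G -> int}.
Proof.
case/and3P; case: p => // e p _ cp _.
have tele e' q :
    path (fun e f => (target e == source f) && (f != inv e)) e' q ->
    \sum_(e <- q) (gen (target e) - gen (source e))
      = gen (target (last e' q)) - gen (target e') :> {ffun vertex G -> int}.
  elim: q e' => [e' _|e'' q IH e' /= /andP[/andP[/eqP E _] /IH IHq]].
    by rewrite big_nil subrr.
  by rewrite big_cons IHq E addrC subrKA.
have := tele _ _ cp; rewrite last_rcons subrr => E; apply: etrans E.
by rewrite big_cons -cats1 big_cat big_seq1 [LHS]addrC.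
Qed.

(** The successor of e in the circuit starts at the target of e, as [inv e] does. Sources being
    distinct, [inv e] in p would be that successor, which the definition of a circuit forbids. In a
    circuit of length 1 the successor is e itself. *)
Lemma circuit_inv_notin (p : seq (edge G)) e : circuit p -> ohead p = Some e ->
  inv e \notin p.
Proof.
case/and3P; case: p => // e' p _ cp up [E]; subst e'; apply/negP => ie.
have [e' e'p /andP[/eqP te /eqP ne]] : exists2 e', e' \in e :: p &
    (target e == source e') && (e' != inv e).
  case: p cp {up ie} => [|e' p] /= /andP[Re _]; first by exists e; rewrite ?mem_head.
  by exists e'; rewrite ?in_cons ?eqxx ?orbT.
by apply: ne; apply: (map_uniq_in_inj up); rewrite ?source_inv.
Qed.

(* In a nonzero cycle every vertex entered by an edge of positive coefficient is
   left by one, so following such edges closes up into a circuit. *)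
Lemma acyclic_Z1 S : subgraph S -> acyclic S <-> forall c, Z1 S c -> c = 0.
Proof.
move=> sS.
set A := S :&: pos_edges G; pose f : 'I_#|A| -> edge G := enum_val.
have f_inj : injective f by exact: enum_val_inj.
have f_pos j : f j \in pos_edges G by have := enum_valP j; rewrite inE => /andP[].
have SE : symcl [set f j | j in 'I_#|A|] = S.
  by rewrite [X in symcl X]imset_enum_val symcl_pos.
have onP c : chains_on S c <-> exists y, c = chain_of f y.
  by rewrite -{1}SE; apply: chains_onP.
split=> [aS c [cS c0]|Z0 p cp pS].
  apply: contrapT => /eqP c_neq0.
  have [y cE] := (onP c).1 cS.
  have [e0 e0_gt0] : exists e, 0 < edge_coef e c.
    have [j yj] : exists j, y 0 j != 0.
      apply/existsP; apply: contraNT c_neq0; rewrite negb_exists => /forallP y0.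
      rewrite cE (_ : y = 0) ?raddf0 //; apply/rowP => j.
      by rewrite mxE; apply/eqP; rewrite -[_ == _]negbK.
    move: yj; rewrite -(edge_coef_chain_of f_inj f_pos) -cE neq_lt => /orP[yj|yj].
      by exists (inv (f j)); rewrite edge_coefN oppr_gt0.
    by exists (f j).
  pose out v e := (source e == v) && (0 < edge_coef e c).
  have outE e : 0 < edge_coef e c -> exists e', out (target e) e'.
    move=> e_gt0; have /eqP := boundary_vertex c (target e).
    rewrite c0 ffunE (bigD1 e) //= eq_sym => /eqP sum0.
    have [e' /andP[/eqP te' _] e'_lt0] : exists2 e', (target e' == target e) && (e' != e)
        & edge_coef e' c < 0.
      apply: contrapT => H; move: e_gt0; apply/negP; rewrite -leNgt.
      rewrite -sum0 lerDl sumr_ge0 // => e' He'; rewrite leNgt; apply/negP => e'_lt0.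
      by apply: H; exists e'.
    by exists (inv e'); rewrite /out source_inv te' eqxx edge_coefN oppr_gt0.
  (* The default [e0] is taken only at vertices that no positive coefficient leaves, and the orbit
     of [source e0] never meets one ([outI]). *)
  pose nxt v := odflt e0 [pick e | out v e].
  have nxtP v : (exists e, out v e) -> out v (nxt v).
    by rewrite /nxt; case: pickP => //= no [e]; rewrite no.
  pose g v := target (nxt v).
  have outI i : exists e, out (iter i g (source e0)) e.
    elim: i => [|i IH /=]; first by exists e0; rewrite /out eqxx.
    by have /andP[_ /outE] := nxtP _ IH.
  have [i [p [p0 cp up pE]]] := periodic_point g (source e0).
  have outp v : v \in p -> out v (nxt v).
    rewrite pE => /trajectP[l _ ->]; rewrite -iterD; exact/nxtP/outI.
  have src : map (source \o nxt) p = p.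
    by apply: map_id_in => v /outp/andP[/eqP].
  apply: (aS (map nxt p)).
    apply/and3P; split; first by case: (p) p0.
    - rewrite cycle_map; apply: (@sub_in_cycle _ (mem p)) cp; last by apply/allP.
      move=> v w /outp/andP[_ v_gt0] /outp/andP[/eqP wE w_gt0] /eqP gv /=.
      (* Two consecutive edges are not inverse to each other, since both have a positive
         coefficient. *)
      rewrite wE -gv eqxx /= gv; apply: contraTneq w_gt0 => ->.
      by rewrite edge_coefN oppr_gt0 -leNgt ltW.
    by rewrite -map_comp src.
  move=> _ /mapP[v /outp/andP[_ v_gt0] ->]; apply: contraT => nS.
  by rewrite (edge_coef_notin sS cS nS) ltxx in v_gt0.
(* Conversely, the edges of a circuit add up to a cycle; its coefficient at the first edge e is
   positive because [inv e] does not occur in the circuit. *)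
pose c := \sum_(e <- p) edge_chain e.
have c0 : c = 0.
  apply: Z0; split; last first.
    rewrite /c (raddf_sum (@boundary G)); apply: etrans (circuit_boundary cp).
    by apply: eq_bigr => e _ /=; rewrite boundary_edge.
  rewrite /c big_seq; elim/big_ind: _ => [|c1 c2 /onP[y1 ->] /onP[y2 ->]|e ep].
  - by apply/onP; exists 0; rewrite raddf0.
  - by apply/onP; exists (y1 + y2); rewrite raddfD.
  by apply/onP; apply: edge_chain_of; rewrite SE; apply: pS.
have [e [q pE]] : exists e q, p = e :: q.
  by case: (p) cp => [|e q] cp; [case/and3P: cp | exists e, q].
subst p.
have := circuit_inv_notin cp (erefl (Some e)); rewrite in_cons => /norP[_ iep].
have := congr1 (edge_coef e) c0; rewrite raddf0 /c raddf_sum big_cons /= edge_coef_edge.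
rewrite eqxx eq_sym (negPf (inv_neq e)) subr0 => /eqP.
rewrite paddr_eq0 ?oner_eq0 // big_seq sumr_ge0 // => e' e'p.
rewrite edge_coef_edge (_ : e' == inv e = false) ?subr0 ?ler0n //.
by apply: contraNF iep => /eqP <-.
Qed.

(** The empty family is a Z-basis of the cycles exactly when they all vanish. *)
Lemma spanning_trees_betti0 : spanning_trees G = connected_subgraphs G 0.
Proof.
apply/setP => S; rewrite !inE.
have [sS|//] := boolP (subgraph S); rewrite /=; congr (_ && _); apply: asbool_equiv_eq.
rewrite acyclic_Z1 //; split=> [Z0|[z [_ zU]] c /zU[a [-> _]]]; last by rewrite big_ord0.
exists (fun=> 0); split=> [[]//|c /Z0 ->]; exists [ffun=> 0].
by split=> [|a _]; [rewrite big_ord0 | apply/ffunP => -[]].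
Qed.

End Trees.

(** * The minors of the Cauchy-Binet sum, for one set of n + k positive edges *)

Section CycleDeterminants.
Variable G : graph.
Local Notation inv := (@Defs.inv G).
Variables (r : vertex G) (k : nat).
Local Notation n := #|[set~ r]|.
Variables (K : numFieldType) (f : 'I_(n + k) -> edge G) (Theta : 'M[K]_(n + k, k)).
Hypotheses (f_inj : injective f) (f_pos : forall j, f j \in pos_edges G).
Local Notation S := (symcl [set f j | j in 'I_(n + k)]).
Local Notation vv := (enum_val : 'I_n -> vertex G).
Local Notation D := (map_mx intr (incidence f r) : 'M[K]_(n + k, n)).

(** The determinant is a unit of the integers, hence 1 or -1. *)
Lemma norm_det_intr p (A B : 'M[int]_p) : A *m B = 1%:M ->
  `|\det (map_mx intr A : 'M[K]_p)| = 1.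
Proof.
move=> /(congr1 determinant); rewrite det_mulmx det1 det_map_mx mulrC => /intUnitRing.unitzPl.
by rewrite qualifE /= => /pred2P[] ->; rewrite ?rmorphN1 ?normrN ?rmorph1 normr1.
Qed.

Lemma det_connected (z : 'I_k -> C1 G) : connected S -> Z_basis (Z1 S) z ->
  `|\det (row_mx D Theta)| = `|\det (map_mx intr (cycle_mx f z) *m Theta)|.
Proof.
move=> cS zB; have [P PD] := incidence_section r cS.
have [B _ PB] := cycle_mx_unimodular f_inj f_pos zB PD.
(* The left factor is unimodular, so it does not change the absolute value of the determinant; [P]
   sends the incidence block to 1 and the cycles send it to 0. *)
have E : map_mx intr (col_mx P (cycle_mx f z)) *m row_mx D Theta
    = block_mx 1%:M (map_mx intr P *m Theta) 0 (map_mx intr (cycle_mx f z) *m Theta).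
  rewrite map_col_mx mul_col_row -!map_mxM PD (cycle_mx_incidence r f_inj f_pos zB).
  by rewrite map_mx1 map_mx0.
have := congr1 (fun M => `|\det M|) E.
by rewrite det_mulmx normrM (norm_det_intr PB) det_ublock det1 !mul1r.
Qed.

(** The indicator [C] of the vertices not reachable from r takes the same value at both ends of
    every edge and vanishes at r. Completed by zeros it is a nonzero vector in the kernel of the
    transposed matrix. *)
Lemma det_disconnected : ~~ connected S -> \det (row_mx D Theta) = 0.
Proof.
have sS := symcl_subgraph [set f j | j in 'I_(n + k)].
move=> ncS; have [v rv] : exists v, ~~ connect (adjacent S) r v.
  apply/existsP; apply: contraNT ncS; rewrite negb_exists => /forallP rS.
  by apply: (connected_root (r := r) sS) => v; have := rS v; rewrite negbK.
pose C w := ~~ connect (adjacent S) r w.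
have Cedge j : C (target (f j)) = C (source (f j)).
  congr (~~ _); apply/idP/idP => rw; apply: connect_trans rw (connect1 _).
    apply/exists_inP; exists (inv (f j)); last by rewrite source_inv target_inv !eqxx.
    exact/(forall_inP sS)/f_symcl.
  by apply/exists_inP; exists (f j); rewrite ?f_symcl ?eqxx.
have Cr : C r = false by rewrite /C connect0.
have [i vE] : exists i, v = vv i by apply: vv_onto; apply: contraNneq rv => ->.
pose g : 'rV[K]_(n + k) := row_mx (\row_i (C (vv i))%:R) 0.
apply/eqP; rewrite -det_tr; apply/det0P; exists g.
  apply/eqP => /(congr1 (@lsubmx _ _ _ _)); rewrite row_mxKl linear0 => /rowP/(_ i).
  by rewrite !mxE -vE /C rv => /eqP; rewrite oner_eq0.
rewrite tr_row_mx mul_row_col mul0mx addr0; apply/rowP => j.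
have genE w : \sum_i (C (vv i))%:R * (gen w (vv i))%:~R = (C w)%:R :> K.
  have [->|/vv_onto[l ->]] := eqVneq w r.
    by rewrite Cr big1 // => l _; rewrite ffunE (negPf (vv_neq l)) mulr0.
  rewrite (bigD1 l) //= big1 ?addr0 => [|l' l'l]; rewrite ffunE ?eqxx ?mulr1//.
  by rewrite (inj_eq enum_val_inj) (negPf l'l) mulr0.
rewrite !mxE; under eq_bigr do rewrite !mxE ffunE [X in _ + X]ffunE rmorphB mulrBr.
by rewrite sumrB !genE Cedge subrr.
Qed.

End CycleDeterminants.

(** * Subgraphs encoded by their sets of positive edges *)

Section Reindexing.
Variables (G : graph) (r : vertex G).
Local Notation n := #|[set~ r]|.
Implicit Types A S : {set edge G}.

Lemma symclK A : A \subset pos_edges G -> symcl A :&: pos_edges G = A.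
Proof.
move/fintype.subsetP => Ap; apply/setP => e; rewrite inE in_symcl.
have [eA|eA] := boolP (e \in A); first by rewrite Ap.
apply/negP => /= /andP[/Ap]; rewrite pos_edges_inv; exact/negP.
Qed.

(** For connected subgraphs, fixing the Betti number amounts to fixing the number of edges, so the
    sum over subgraphs takes the shape of a Cauchy-Binet sum. *)
Lemma symcl_connected_subgraphs k A : A \subset pos_edges G ->
  (symcl A \in connected_subgraphs G k) = (#|A| == (n + k)%N) && connected (symcl A).
Proof.
move=> /fintype.subsetP Ap; rewrite inE symcl_subgraph /= andbC.
have [cA|] := boolP (connected (symcl A)); rewrite ?andbF// !andbT.
pose f : 'I_#|A| -> edge G := enum_val.
have f_inj : injective f by exact: enum_val_inj.
have f_pos j : f j \in pos_edges G by exact/Ap/enum_valP.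
have AE : symcl [set f j | j in 'I_#|A|] = symcl A by rewrite imset_enum_val.
rewrite -AE in cA *; have [P PD] := incidence_section r cA.
apply/asboolP/eqP => [[z zB]|AE'].
  exact: (card_connected f_inj f_pos zB PD).
exact: (betti1_connected f_inj f_pos PD AE').
Qed.

Lemma sum_connected_subgraphs (K : nmodType) k (W : {set edge G} -> K) :
  \sum_(S in connected_subgraphs G k) W S =
  \sum_(A : {set edge G} | #|A| == (n + k)%N)
     if (A \subset pos_edges G) && connected (symcl A) then W (symcl A) else 0.
Proof.
rewrite (reindex_onto (@symcl G) (fun S => S :&: pos_edges G)) /=; last first.
  by move=> S; rewrite inE => /and3P[sS _ _]; apply: symcl_pos.
rewrite -big_mkcondr; apply: eq_bigl => A.
have [Ap|nAp] := boolP (A \subset pos_edges G).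
  by rewrite symclK // eqxx andbT symcl_connected_subgraphs.
rewrite /= andbF; apply/negbTE; apply: contra nAp => /andP[_ /eqP <-].
exact: finset.subsetIr.
Qed.

End Reindexing.

(** * Weighted Gram determinants of exact forms and of the theta_i *)

Section WeightedGraph.
Variables (R : realType) (F : field_kind) (G : graph) (x : weights R F G).
Local Notation K := (scalars R F).
Local Notation inv := (@Defs.inv G).
Local Notation d := (Defs.d R F G).
Local Notation inner0 := (Defs.inner0 R F G).
Variable r : vertex G.
Local Notation n := #|[set~ r]|.
Local Notation vv := (enum_val : 'I_n -> vertex G).

Definition indicator (v : vertex G) : Omega0 R F G := [ffun w => (w == v)%:R].

Definition join_fam (T : Type) m p (a : 'I_m -> T) (b : 'I_p -> T) (i : 'I_(m + p)) :=
  match split i with inl j => a j | inr j => b j end.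

Lemma join_faml (T : Type) m p (a : 'I_m -> T) (b : 'I_p -> T) i :
  join_fam a b (lshift p i) = a i.
Proof. by rewrite /join_fam (unsplitK (inl i)). Qed.

Lemma join_famr (T : Type) m p (a : 'I_m -> T) (b : 'I_p -> T) i :
  join_fam a b (rshift m i) = b i.
Proof. by rewrite /join_fam (unsplitK (inr i)). Qed.

(** [weight_set] symmetrises its argument once more, which changes nothing here, and then keeps the
    positive edges, that is, the image of f. *)
Lemma weight_symcl N (f : 'I_N -> edge G) : injective f ->
  \prod_j (if f j \in pos_edges G then x (f j) else 0)
  = if [set f j | j in 'I_N] \subset pos_edges G
    then weight_set x (symcl [set f j | j in 'I_N]) else 0.
Proof.
move=> f_inj; case: ifPn => [fp|/subsetPn[_ /imsetP[j _ ->] /negPf fj]]; last first.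
  by rewrite (bigD1 j) //= fj mul0r.
have sE : symcl [set f j | j in 'I_N] :|: inv @: symcl [set f j | j in 'I_N]
    = symcl [set f j | j in 'I_N].
  apply/setP => e; rewrite -[_ :|: _]/(symcl (symcl _)) !in_symcl Defs.invK.
  by rewrite [X in _ || X]orbC orbb.
rewrite /weight_set sE symclK // big_imset /=; last by move=> i j _ _; apply: f_inj.
apply: eq_bigr => j _; rewrite ifT //; apply: (fintype.subsetP fp).
exact: imset_f.
Qed.

Section Theta.
Variables (k : nat) (theta : k.-tuple (Omega1 R F G)).

Definition cut_cycle_fam : 'I_(n + k) -> Omega1 R F G :=
  join_fam (fun i => d (indicator (vv i))) (tnth theta).

Lemma sum_cycle_det (Z : {set edge G} -> 'I_k -> C1 G) :
  (forall S, S \in connected_subgraphs G k -> Z_basis (Z1 S) (Z S)) ->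
  \sum_(S in connected_subgraphs G k)
    `| \det (\matrix_(i < k, j < k) on_chain (tnth theta i) (Z S j)) | ^+ 2
      * weight_set x S
  = \det (gram (inner1 x) cut_cycle_fam).
Proof.
move=> zB; rewrite (sum_connected_subgraphs r).
pose a (i : 'I_(n + k)) e := on_edge (cut_cycle_fam i) e.
(* The inner product runs over positive edges only; a weight 0 elsewhere extends it to all edges.
   The family [a'] absorbs both weight and conjugation, to match the bilinear form of
   [cauchy_binet]. *)
pose m e : K := if e \in pos_edges G then x e else 0.
pose a' (i : 'I_(n + k)) e := sconj (a i e) * m e.
have -> : gram (inner1 x) cut_cycle_fam = \matrix_(i, j) \sum_e a i e * a' j e.
  apply/matrixP => i j; rewrite !mxE [LHS]/(form1 _ _ _) /form1 big_mkcond /=.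
  apply: eq_bigr => e _; rewrite /a' /m; case: ifP => _; last by rewrite !mulr0.
  by rewrite mulrC -mulrA.
apply/esym/cauchy_binet => f f_inj.
set A := [set f j | j in 'I_(n + k)].
have det_a' : \det (\matrix_(i, j) a' i (f j))
    = sconj (\det (\matrix_(i, j) a i (f j))) * \prod_j m (f j).
  rewrite -det_map_mx -[\prod_j _](_ : \det (diag_mx (\row_j m (f j))) = _); last first.
    by rewrite det_diag; apply: eq_bigr => j _; rewrite mxE.
  by rewrite -det_mulmx mul_mx_diag; congr (\det _); apply/matrixP => i j; rewrite !mxE.
rewrite det_a' mulrA mul_sconj weight_symcl // -/A.
case: ifP => [Ap|_]; last by rewrite mulr0.
have f_pos j : f j \in pos_edges G by apply: (fintype.subsetP Ap); apply: imset_f.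
pose Theta := \matrix_(j, i) on_edge (tnth theta i) (f j).
have aE : \det (\matrix_(i, j) a i (f j))
    = \det (row_mx (map_mx intr (incidence f r)) Theta).
  rewrite -[RHS]det_tr; congr (\det _); apply/matrixP => i j.
  rewrite !mxE /a /cut_cycle_fam /join_fam; case: (split i) => l; rewrite !mxE //.
  by rewrite dE !ffunE rmorphB /= !rmorph_nat ![vv l == _]eq_sym.
rewrite aE /=; have [cA|ncA] := boolP (connected (symcl A)); last first.
  by rewrite det_disconnected // normr0 expr0n mul0r.
have AC : symcl A \in connected_subgraphs G k.
  by rewrite (symcl_connected_subgraphs r) // cA card_imset // card_ord eqxx.
rewrite (det_connected Theta f_inj f_pos cA (zB _ AC)) -/A.
congr (_ ^+ 2 * _); congr (`|_|); rewrite -[RHS]det_tr; congr (\det _).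
apply/matrixP => i j; rewrite !mxE.
rewrite (cycle_mxE r f_inj f_pos (zB _ AC)).
(* Evaluating theta_j on the expansion of the cycle along the edges [f l] gives the entry of the
   matrix product. *)
pose h := on_chain (tnth theta j).
have h_zmod : zmod_morphism h := on_chain_zmod (tnth theta j).
pose H : {additive C1 G -> K} :=
  HB.pack h (GRing.isZmodMorphism.Build _ _ h h_zmod).
rewrite [RHS](_ : _ = H (chain_of f (row i (cycle_mx f (Z (symcl A)))))) //.
rewrite /chain_of raddf_sum; apply: eq_bigr => l _.
by rewrite raddfMz /= /h on_chain_edge !mxE mulrC mulrzr.
Qed.

Lemma omega0_decomp (g : Omega0 R F G) :
  g = g r *: [ffun=> 1] + \sum_i (g (vv i) - g r) *: indicator (vv i).
Proof.
apply/ffunP => w; rewrite !ffunE sum_ffunE.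
have [->|/vv_onto[l ->]] := eqVneq w r.
  rewrite big1 ?addr0 => [|i _]; first by rewrite /GRing.scale /= mulr1.
  by rewrite !ffunE eq_sym (negPf (vv_neq i)) scaler0.
rewrite (bigD1 l) //= big1 ?addr0 => [|i il].
  by rewrite !ffunE eqxx /GRing.scale /= !mulr1 subrKC.
by rewrite !ffunE (inj_eq enum_val_inj) eq_sym (negPf il) scaler0.
Qed.

Lemma d_const (c : K) : d [ffun=> c] = 0.
Proof. by apply: on_edge_inj => e; rewrite dE !ffunE subrr [RHS]ffunE. Qed.

Lemma d_indicator (g : Omega0 R F G) :
  d g = \sum_i (g (vv i) - g r) *: d (indicator (vv i)).
Proof.
rewrite {1}[g]omega0_decomp linearD linearZ /= d_const scaler0 add0r linear_sum.
by apply: eq_bigr => i _; rewrite linearZ.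
Qed.

Local Notation proj := (oproj (inner1 x) (lker (dstar x))).

Lemma dstar_kerP w : w \in lker (dstar x) <-> forall g, inner1 x (d g) w = 0.
Proof.
rewrite memv_ker; split=> [/eqP w0 g|w0].
  by rewrite (adjointE inner0) -/(dstar x) w0 linear0r.
apply/eqP; apply: (inner_eq0 (f := inner0)).
by rewrite -(adjointE inner0 (inner1 x) d) w0.
Qed.

(** Let p and q be the projections of w on ker d* and on im d. Then w - p - q lies in ker d* and is
    orthogonal to it, so it is 0 and w - p = q is exact. *)
Lemma sub_oproj_exact w : exists g, w - proj w = d g.
Proof.
have [pK pO] := oprojP (inner1 x) (lker (dstar x)) w.
have [qI qO] := oprojP (inner1 x) (limg d) w.
set p := proj w in pK pO *; set q := oproj _ _ w in qI qO.
have /memv_imgP[g _ qE] := qI; exists g; rewrite -qE.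
have qK : w - q \in lker (dstar x).
  apply/dstar_kerP => h; rewrite innerC (mem_orthovP qO) ?rmorph0 //.
  by rewrite memv_img ?memvf.
have qO' : q \in orthov (inner1 x) (lker (dstar x)).
  by apply/mem_orthovP => h /dstar_kerP hK; rewrite qE; exact: hK.
pose y := w - p - q.
have yO : y \in orthov (inner1 x) (lker (dstar x)) by apply: memvB.
have yK : y \in lker (dstar x).
  by rewrite /y -addrA [- p - q]addrC addrA; apply: memvB.
by apply/eqP; rewrite -subr_eq0 -/y (inner_eq0 (mem_orthovP yO y yK)).
Qed.

Lemma det_gram_cut_cycle :
  \det (gram (inner1 x) cut_cycle_fam)
  = \det (gram (inner1 x) (fun i => d (indicator (vv i))))
    * \det (gram (inner1 x) (fun j => proj (tnth theta j))).
Proof.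
have /fin_all_exists[g gE] j := sub_oproj_exact (tnth theta j).
pose b := join_fam (fun i => d (indicator (vv i))) (fun j => proj (tnth theta j)).
(* theta_j differs from its projection by d g_j; by [d_indicator], row j of [C] holds the
   coordinates of d g_j in the differentials of the indicators. *)
pose C : 'M[K]_(k, n) := \matrix_(j, i) (g j (vv i) - g j r).
rewrite (@det_gram_unitriangular _ _ _ _ _ (block_mx 1%:M 0 C 1%:M) b).
- rewrite det_gram_split => [|i j].
    by congr (_ * _); congr (\det _); apply/matrixP => i j;
      rewrite !mxE /b ?join_faml ?join_famr.
  rewrite /b join_faml join_famr; apply/(dstar_kerP _).1.
  by have [] := oprojP (inner1 x) (lker (dstar x)) (tnth theta j).
- move=> s; rewrite big_split_ord /= /cut_cycle_fam -[s]splitK.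
  case: (split s) => j /=; rewrite ?join_faml ?join_famr.
    rewrite (bigD1 j) //= big1 => [|l lj].
      rewrite block_mxEul mxE eqxx scale1r addr0 big1 ?addr0 /b ?join_faml // => l _.
      by rewrite block_mxEur mxE scale0r.
    by rewrite block_mxEul mxE eq_sym (negPf lj) scale0r.
  rewrite addrC (bigD1 j) //= big1 => [|l lj]; last first.
    by rewrite block_mxEdr mxE eq_sym (negPf lj) scale0r.
  rewrite block_mxEdr mxE eqxx scale1r addr0 /b join_famr.
  rewrite -[LHS](subrKC (proj (tnth theta j))) gE d_indicator; congr (_ + _).
  by apply: eq_bigr => l _; rewrite block_mxEdl mxE join_faml.
by rewrite det_lblock !det1 mulr1.
Qed.

End Theta.

(** This is the case k = 0 of [sum_cycle_det], where the cycle determinants are empty and equal to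
    1. *)
Lemma sum_spanning_trees : \sum_(S in spanning_trees G) weight_set x S
  = \det (gram (inner1 x) (fun i => d (indicator (vv i)))).
Proof.
rewrite spanning_trees_betti0.
transitivity (\det (gram (inner1 x) (cut_cycle_fam [tuple]))); last first.
  by rewrite det_gram_cut_cycle [X in _ * X]det_mx00 mulr1.
rewrite -(@sum_cycle_det 0 [tuple] (fun _ _ => 0)) => [|S].
  by apply: eq_bigr => S _; rewrite det_mx00 normr1 expr1n mul1r.
rewrite inE => /and3P[_ _ /asboolP[z zB]].
by rewrite (_ : (fun=> 0) = z) //; apply/funext => -[].
Qed.

(** * The determinant of the Laplacian on a connected graph *)

Section Laplacian.
Variables (k : nat) (theta : k.-tuple (Omega1 R F G)).
Hypothesis cG : connected [set: edge G].

Lemma lker_dE : lker d = <[[ffun=> 1] : Omega0 R F G]>%VS.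
Proof.
apply/eqP; rewrite eqEsubv; apply/andP; split; last first.
  by rewrite -memvE memv_ker d_const.
apply/subvP => g; rewrite memv_ker => /eqP dg0; apply/vlineP; exists (g r).
have edge_eq e : g (target e) = g (source e).
  by apply/eqP; rewrite -subr_eq0 -dE dg0 [X in X == 0]ffunE.
apply/ffunP => v; rewrite !ffunE /GRing.scale /= mulr1.
have /andP[_ /forallP/(_ r)/forallP/(_ v)/connectP[p]] := cG.
elim/last_ind: p v => [v _ -> //|p u IH v].
rewrite rcons_path last_rcons => /andP[/IH/(_ erefl) <-].
by move=> /exists_inP[e _ /andP[/eqP <- /eqP <-]] ->.
Qed.

Lemma card_vertex : #|vertex G| = n.+1.
Proof. by rewrite cardsC1 prednK //; apply/card_gt0P; exists r. Qed.

Local Notation c := (#|vertex G|%:R^-1 : K).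
Local Notation U := (subvs_of (orthov inner0 (lker d)) * {ffun 'I_k -> K^o})%type.

(** The projection of the indicator on the orthogonal of the constants, that is, on (ker d)^perp
    when G is connected; it has the same image under d. *)
Definition centered (v : vertex G) : Omega0 R F G := indicator v - c *: [ffun=> 1].

Lemma centered_inner v w : inner0 (centered v) (centered w) = (v == w)%:R - c.
Proof.
have c0 : #|vertex G|%:R != 0 :> K by rewrite card_vertex pnatr_eq0.
have ccE : sconj c = c by rewrite fmorphV rmorph_nat.
have sum1 u : \sum_(z : vertex G) (z == u)%:R = 1 :> K.
  by rewrite (bigD1 u) //= eqxx big1 ?addr0 // => z /negPf ->.
rewrite [LHS]/(std_form _ _) /std_form.
transitivity (\sum_(z : vertex G)
    ((z == v)%:R * (z == w)%:R - (z == v)%:R * c - (z == w)%:R * c + c * c)).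
  apply: eq_bigr => z _; rewrite !ffunE /GRing.scale /= !mulr1 rmorphB /=.
  by rewrite rmorph_nat ccE mulrBl !mulrBr opprB addrA [c * (z == w)%:R]mulrC addrAC.
rewrite big_split !sumrB -!mulr_suml !sum1 !mul1r /= sumr_const -[X in _ + X * _]mulr_natl.
rewrite mulfV // mul1r subrK; congr (_ - _).
rewrite (bigD1 v) //= eqxx mul1r big1 ?addr0 // => z /negPf ->.
by rewrite mul0r.
Qed.

Lemma centered_orthov v : centered v \in orthov inner0 (lker d).
Proof.
rewrite lker_dE mem_orthov1; apply/eqP; rewrite [LHS]/(std_form _ _) /std_form.
under eq_bigr do rewrite !ffunE rmorph1 mulr1 /GRing.scale /= mulr1.
rewrite sumrB (bigD1 v) //= eqxx big1 ?addr0 => [|w /negPf -> //].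
by rewrite sumr_const -[c *+ _]mulr_natl mulfV ?subrr // card_vertex pnatr_eq0.
Qed.

Definition domain_fam : 'I_(n + k) -> U :=
  join_fam (fun i => (Subvs (centered_orthov (vv i)), 0) : U)
           (fun j => (0, [ffun l => (l == j)%:R]) : U).

(** Since ker d is the line of constants, its orthogonal has dimension |V| - 1 = n. *)
Lemma dim_domain : (n + k)%N = \dim {: U}.
Proof.
have one_nradical : ([ffun=> 1] : Omega0 R F G) \notin orthov inner0 fullv.
  apply/mem_orthovPn; exists [ffun=> 1]; first exact: memvf.
  apply: lt0r_neq0; apply: neq0_dnorm_gt0; apply/eqP => /ffunP/(_ r).
  by rewrite !ffunE => /eqP; rewrite oner_eq0.
have := eq_dim_orthov1 one_nradical; rewrite capfv -lker_dE dimvf.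
rewrite [dim _](_ : _ = #|vertex G| * 1)%N // muln1 card_vertex /= => ->.
rewrite dimvf [dim _](_ : _ = dim (subvs_of (orthov inner0 (lker d))) + #|'I_k| * 1)%N //.
by rewrite card_ord muln1.
Qed.

Lemma d_omega_domain_fam i : d_omega theta (domain_fam i) = cut_cycle_fam theta i.
Proof.
rewrite lfunE /= /d_omega_fun /domain_fam /cut_cycle_fam /join_fam.
case: (split i) => j /=.
  rewrite linear0 addr0 /centered linearB linearZ /= d_const scaler0 subr0.
  by [].
rewrite linear0 add0r lfunE /= /omega_fun (bigD1 j) //= ffunE eqxx scale1r.
by rewrite big1 ?addr0 // => l /negPf lj; rewrite ffunE lj scale0r.
Qed.

Lemma inner_zeror (V : vectType K) (g : inner R F V) u : g u 0 = 0.
Proof. exact: linear0r. Qed.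

Lemma inner_zerol (V : vectType K) (g : inner R F V) u : g 0 u = 0.
Proof. by rewrite innerC inner_zeror rmorph0. Qed.

(** The family on K^k is orthonormal. The Gram matrix of the centered indicators is the identity
    minus the matrix with all entries c = 1/(n+1), a rank one matrix, so its determinant is 1 - n c
    = c. *)
Lemma det_gram_domain : \det (gram (inner_domain R F G k) domain_fam) = c.
Proof.
rewrite det_gram_split => [|i j]; last first.
  rewrite /domain_fam join_faml join_famr.
  apply: etrans (congr2 +%R (inner_zeror (inner_sub inner0 _) _)
                            (inner_zerol (inner_std R F 'I_k) _)) _.
  exact: addr0.
have -> : gram (inner_domain R F G k) (fun j => domain_fam (rshift n j)) = 1%:M.
  apply/matrixP => i j; rewrite !mxE /domain_fam !join_famr.
  apply: etrans (congr1 (+%R^~ _) (inner_zerol (inner_sub inner0 _) _)) _.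
  rewrite add0r [LHS]/(std_form _ _) /std_form (bigD1 i) //= !ffunE eqxx mul1r rmorph_nat.
  by rewrite big1 ?addr0 // => l /negPf li; rewrite ffunE li mul0r.
have -> : gram (inner_domain R F G k) (fun i => domain_fam (lshift k i))
    = 1%:M - (const_mx c : 'M_(n, 1)) *m (const_mx 1 : 'M_(1, n)).
  apply/matrixP => i j; rewrite !mxE /domain_fam !join_faml.
  apply: etrans (congr1 (+%R _) (inner_zerol (inner_std R F 'I_k) _)) _.
  rewrite addr0; apply: etrans (centered_inner (vv i) (vv j)) _.
  by rewrite big_ord1 !mxE mulr1 (inj_eq enum_val_inj).
rewrite det1 mulr1 det_1B_mulC det_mx11 !mxE eqxx.
under eq_bigr do rewrite !mxE mul1r.
rewrite sumr_const card_ord -[c *+ _]mulr_natl.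
have c0 : #|vertex G|%:R != 0 :> K by rewrite card_vertex pnatr_eq0.
apply: (mulfI c0); rewrite mulrBr mulr1 mulrCA mulfV // mulr1.
by rewrite card_vertex -[n.+1]add1n natrD addrK.
Qed.

Lemma det_Delta : #|vertex G|%:R^-1 * lfun_det (Delta x theta)
  = \det (gram (inner1 x) (cut_cycle_fam theta)).
Proof.
rewrite mulrC -det_gram_domain det_adjoint_comp; last exact: dim_domain.
by congr (\det _); apply/matrixP => i j; rewrite !mxE !d_omega_domain_fam.
Qed.

End Laplacian.
End WeightedGraph.

Theorem proposition8p2 (R : realType) (F : field_kind) (G : graph)
    (x : weights R F G) (k : nat) (theta : k.-tuple (Omega1 R F G))
    (Z : {set edge G} -> 'I_k -> C1 G) :
  connected [set: edge G] ->
  free theta ->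
  (limg (d R F G) :&: <<theta>>)%VS = 0%VS ->
  (forall S, S \in connected_subgraphs G k -> Z_basis (Z1 S) (Z S)) ->
  let C_k := \sum_(S in connected_subgraphs G k)
    `| \det (\matrix_(i < k, j < k) on_chain (tnth theta i) (Z S j)) | ^+ 2
      * weight_set x S in
  let T := \sum_(S in spanning_trees G) weight_set x S in
  let proj_theta :=
    ext_map (oproj (inner1 x) (lker (dstar x))) (wedge (tnth theta)) in
  C_k = T * ext_inner (inner1 x) proj_theta proj_theta /\
  T * ext_inner (inner1 x) proj_theta proj_theta
    = #|vertex G|%:R^-1 * lfun_det (Delta x theta).
Proof.
move=> cG _ _ zB C_k T proj_theta.
have [r _] : exists r : vertex G, true.
  by have /andP[/card_gt0P[r _] _] := cG; exists r.
have TE : T * ext_inner (inner1 x) proj_theta proj_theta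
    = \det (gram (inner1 x) (cut_cycle_fam (r := r) theta)).
  rewrite /T (sum_spanning_trees x r) /proj_theta ext_map_wedge ext_inner_wedge.
  exact/esym/det_gram_cut_cycle.
by rewrite TE; split; [exact: sum_cycle_det | exact/esym/det_Delta].
Qed.
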